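(* Let $V$ be a countably-Hilbert space with dual $V'$. Then the inductive limit topology, the strong topology and the Mackey topology on $V'$ are equal.
   Context: A countably-normed space is a topological vector space $V$ over $\mathbb{C}$ whose topology is generated by a countable family of norms $\{|\cdot|_n : n=1,2,\dots\}$. It is a countably-Hilbert space if moreover each $|\cdot|_n$ is an inner product norm and $V$ is complete. The norms are taken to be increasing, $|v|_1\le |v|_2\le\cdots$ for all $v\in V$; $V_n$ denotes the completion of $V$ in $|\cdot|_n$, and the natural maps are regarded as inclusions $V\subset\cdots\subset V_{n+1}\subset V_n\subset\cdots\subset V_1$. $V'$ is the space of continuous linear functionals on $V$, with pairing $\langle v',v\rangle$; $V_n'$ is the dual of the Banach space $V_n$ with its operator norm $|\cdot|_{-n}$, regarded as a subspace of $V'$ by restricting functionals to $V$; one has $V'=\bigcup_n V_n'$. Topologies on $V'$: - The strong topology has as a base of neighborhoods of $0$ the sets $\{v'\in V' : \sup_{v\in D}|\langle v',v\rangle|<\varepsilon\}$, with $D$ a bounded subset of $V$ and $\varepsilon>0$. ($D\subset V$ is bounded if for every neighborhood $U$ of $0$ there is $\lambda>0$ with $D\subset\lambda U$.) - The inductive limit topology is the finest locally convex vector topology on $V'=\bigcup_n V_n'$ for which every inclusion $V_n'\to V'$ is continuous ($V_n'$ carrying the norm $|\cdot|_{-n}$). - The Mackey topology has as a base of neighborhoods of $0$ the sets $\{v'\in V' : \sup_{v\in C}|\langle v',v\rangle|<\varepsilon\}$, with $\varepsilon>0$ and $C\subset V$ balanced, convex and weakly compact, i.e. compact for the weak topology on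 $V$ (the coarsest topology making every $v'\in V'$ continuous). *)

(* Defs.v *)
From HB Require Import structures.
From mathcomp Require Import all_boot all_order all_algebra.
From mathcomp Require Import finmap complex.
From mathcomp Require Import all_classical all_reals all_analysis.

Set Implicit Arguments.
Unset Strict Implicit.
Unset Printing Implicit Defensive.

Import Order.TTheory GRing.Theory Num.Theory.
Import numFieldNormedType.Exports.
Import Normc.

Local Open Scope classical_set_scope.
Local Open Scope ring_scope.
Local Open Scope complex_scope.

Section Dual.
Context {R : realType}.

Definition dual_pred (V : topologicalLmodType R[i]) : {pred V -> R[i]^o} :=
  fun f => `[< linear f /\ continuous f >].

Record dual (V : topologicalLmodType R[i]) := Dual {
  dual_fun :> V -> R[i]^o ;
  dual_funP : dual_fun \in @dual_pred V }.

Variable V : topologicalLmodType R[i].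

HB.instance Definition _ := [isSub for @dual_fun V].
HB.instance Definition _ := [Choice of dual V by <:].

Lemma dual_linear (f : dual V) : linear f.
Proof. by have /asboolP[] := dual_funP f. Qed.

Lemma dual_continuous (f : dual V) : continuous f.
Proof. by have /asboolP[] := dual_funP f. Qed.

HB.instance Definition _ (f : dual V) :=
  GRing.isLinear.Build R[i] V R[i]^o *:%R f (@dual_linear f).

Lemma dual_pred_submod : submod_closed (@dual_pred V).
Proof.
split=> [|a f g].
  apply/asboolP; split; last by move=> x; exact: cvg_cst.
  by move=> a u v; rewrite /= scaler0 addr0.
move=> /asboolP[lf cf] /asboolP[lg cg]; apply/asboolP; split.
  move=> b u v; rewrite !fctE lf lg !scalerDr !addrA; congr (_ + _).
  by rewrite !scalerA [a * b]mulrC -!addrA; congr (_ + _); rewrite addrC.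
move=> x; rewrite /continuous_at.
apply: (@cvgD _ R[i]^o _ _ _ (fun y => a *: (f y : R[i]^o)) g).
  by apply: cvgZr; exact: cf.
exact: cg.
Qed.

HB.instance Definition _ :=
  GRing.isSubmodClosed.Build R[i] (V -> R[i]^o) (@dual_pred V) dual_pred_submod.
HB.instance Definition _ := [SubChoice_isSubLmodule of dual V by <:].
End Dual.

Section PolarTopology.
Context {R : realType} {V : topologicalLmodType R[i]}.

(* If D is empty the supremum is -oo and [polar D e] is the whole dual. *)
Definition polar (D : set V) (e : R) : set (dual V) :=
  [set f | (ereal_sup [set (normc (f v))%:E | v in D] < e%:E)%E].

(* The open sets of the translation-invariant topology on the dual for which
   the sets [polar D e], with [D] in [S] and [e > 0], form a base of
   neighborhoods of 0. *)
Definition polar_open (S : set_system V) : set_system (dual V) :=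
  [set U | forall f, U f -> exists D e,
    [/\ S D, 0 < e & forall g, polar D e g -> U (f + g)]].

Definition bounded_in (D : set V) := forall U : set V, nbhs (0 : V) U ->
  exists2 l : R[i], 0 < l & D `<=` [set l *: u | u in U].

Definition balanced (C : set V) :=
  forall (a : R[i]) v, `|a| <= 1 -> C v -> C (a *: v).

Definition weak_topology : Type :=
  sup_topology (fun f : dual V =>
    Topological.class (initial_topology (f : V -> R[i]^o))).

HB.instance Definition _ := Topological.on weak_topology.

Definition weakly_compact (C : set V) := compact (C : set weak_topology).

Definition mackey_family : set_system V :=
  [set C | [/\ balanced C, convex_set C & weakly_compact C]].

Lemma polarP D e f :
  polar D e f <-> exists2 r, r < e & forall v, D v -> normc (f v) <= r.
Proof.
rewrite /polar /=; split=> [|[r re Dr]]; last first.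
  apply: (@le_lt_trans _ _ r%:E); last by rewrite lte_fin.
  by apply: ge_ereal_sup => _ [v Dv <-]; rewrite lee_fin; exact: Dr.
set s := ereal_sup _ => se.
have sub v : D v -> ((normc (f v))%:E <= s)%E.
  by move=> Dv; apply: ereal_sup_ubound; exists v.
case: s se sub => [r|//|] se sub.
  by exists r; [rewrite -lte_fin | move=> v /sub; rewrite lee_fin].
by exists (e - 1); [rewrite ltrBlDr ltrDl | move=> v /sub; rewrite leeNy_eq].
Qed.

Lemma normc_ler_norm (x y : R[i]) : normc (x + y) <= normc x + normc y.
Proof. by rewrite -lecR rmorphD; exact: (ler_normD x y). Qed.

Lemma normc_ge0 (x : R[i]) : 0 <= normc x.
Proof. by case: x => *; exact: sqrtr_ge0. Qed.

Lemma polar_le D E e e' :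
  D `<=` E -> e <= e' -> polar E e `<=` polar D e'.
Proof.
move=> DE ee' f /polarP[r re Er]; apply/polarP; exists r.
  exact: lt_le_trans ee'.
by move=> v /DE; exact: Er.
Qed.

Lemma polar0 D e : 0 < e -> polar D e 0.
Proof. by move=> e0; apply/polarP; exists 0 => // v _; rewrite normc0. Qed.

Lemma polar_openT S : S !=set0 -> polar_open S setT.
Proof. by move=> [D SD] f _; exists D, 1; split. Qed.

Lemma polar_openI S :
  (forall D E, S D -> S E -> exists2 F, S F & D `|` E `<=` F) ->
  setI_closed (polar_open S).
Proof.
move=> dirS A B oA oB f [/oA[D [d [SD d0 Dd]]] /oB[E [e [SE e0 Ee]]]].
have [F SF DEF] := dirS _ _ SD SE; exists F, (Num.min d e); split=> //.
  by rewrite lt_min d0.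
move=> g Fg; split; [apply: Dd|apply: Ee]; apply: polar_le Fg.
- by move=> x Dx; apply: DEF; left.
- by rewrite ge_min lexx.
- by move=> x Dx; apply: DEF; right.
- by rewrite ge_min lexx orbT.
Qed.

Lemma polar_open_bigU S (I : Type) (A : I -> set (dual V)) :
  (forall i, polar_open S (A i)) -> polar_open S (\bigcup_i A i).
Proof.
move=> oA f [i _ /oA[D [e [SD e0 De]]]]; exists D, e; split=> // g /De Ag.
by exists i.
Qed.

Lemma polar_open_polar S D e : S D -> polar_open S (polar D e).
Proof.
move=> SD f /polarP[r re Dr]; exists D, (e - r); split=> //.
  by rewrite subr_gt0.
move=> g /polarP[s sre Ds]; apply/polarP; exists (r + s).
  by rewrite -ltrBrDl.
move=> v Dv; apply: le_trans (normc_ler_norm _ _) _.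
by apply: lerD; [exact: Dr | exact: Ds].
Qed.

Lemma bounded_inU D E : bounded_in D -> bounded_in E -> bounded_in (D `|` E).
Proof.
move=> bD bE U U0.
have := @scale_continuous R[i] V (0, 0) U; rewrite /= scaler0 => /(_ U0).
move=> [[A B] /= [/nbhs_norm0P[d /= d0 dA] B0] ABU].
have [l l0 Dl] := bD B B0; have [m m0 Em] := bE B B0.
have lm0 : 0 < l + m by rewrite addr_gt0.
have lm20 : 0 < (l + m) * 2 by rewrite mulr_gt0.
pose k := (l + m) * 2 / d.
have k0 : 0 < k by rewrite !mulr_gt0 ?invr_gt0.
have key a u : 0 < a -> a <= l + m -> B u -> [set k *: w | w in U] (a *: u).
  move=> a0 alm Bu; exists ((a / k) *: u); last first.
    by rewrite scalerA mulrC divfK ?gt_eqF.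
  apply: (ABU (a / k, u)); split => //=; apply: dA => /=.
  rewrite ger0_norm ?divr_ge0 ?ltW//; rewrite ltr_pdivrMr// /k.
  rewrite mulrC divfK ?gt_eqF//.
  by rewrite (le_lt_trans alm)// ltr_pMr// ltr1n.
exists k => // v [/Dl[u Bu <-]|/Em[u Bu <-]]; apply: key => //.
  by rewrite lerDl ltW.
by rewrite lerDr ltW.
Qed.

Lemma weak_cvg (F : set_system V) (x : V) : Filter F ->
  (forall f : dual V, f @ F --> f x) -> F --> (x : weak_topology).
Proof.
move=> FF Ffx; apply/cvg_sup => f A.
rewrite /= (@nbhsE (initial_topology (f : V -> R[i]^o))) =>
  -[_ [[B oB <-] fB] BA]; apply: filterS BA _.
by apply: (Ffx f); exact: open_nbhs_nbhs.
Qed.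

Lemma weak_continuous (f : dual V) :
  continuous (f : weak_topology -> R[i]^o).
Proof.
move=> x; apply: (@cvg_trans _ (f @ nbhs (x : initial_topology f))).
  apply: cvg_app.
  have FF : Filter (nbhs (x : weak_topology)) := nbhs_filter _.
  by have [+ _] := @cvg_sup _ _ _ (nbhs (x : weak_topology)) x FF; apply.
exact: (@initial_continuous _ _ (f : V -> R[i]^o)).
Qed.

Lemma mackey_family_dir D E : mackey_family D -> mackey_family E ->
  exists2 F, mackey_family F & D `|` E `<=` F.
Proof.
have [D0|D0] := pselect (D = set0).
  by move=> _ mE; exists E => // x [|//]; rewrite D0.
have [E0|E0] := pselect (E = set0).
  by move=> mD _; exists D => // x [//|]; rewrite E0.
have zero C : balanced C -> C <> set0 -> C 0.
  move=> bC /eqP/set0P[v Cv]; rewrite -(scale0r v).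
  by apply: bC => //; rewrite normr0.
move=> [bD cD kD] [bE cE kE].
exists [set x.1 + x.2 | x in D `*` E]; last first.
  move=> v [Dv|Ev].
    by exists (v, 0) => /=; [split=> //; exact: zero | rewrite addr0].
  by exists (0, v) => /=; [split=> //; exact: zero | rewrite add0r].
split.
- move=> a _ a1 [[x y] /= [Dx Ey] <-]; exists (a *: x, a *: y) => /=.
    by split; [exact: bD | exact: bE].
  by rewrite scalerDr.
- move=> _ _ l /set_mem[[x y] /= [Dx Ey] <-] /set_mem[[x' y'] /= [Dx' Ey'] <-].
  apply/mem_set.
  exists (conv l (x : convex_lmodType V) x', conv l (y : convex_lmodType V) y').
    split=> /=; apply/set_mem.
      by apply: cD; exact/mem_set.
    by apply: cE; exact/mem_set.
  by rewrite /conv /= !scalerDr addrACA.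
- apply: (@continuous_compact (weak_topology * weak_topology)%type weak_topology
    (fun x => (x.1 : V) + x.2)).
    apply: continuous_subspaceT => x; apply: weak_cvg => f.
    have fE : (fun z : weak_topology * weak_topology => f ((z.1 : V) + z.2)) =
              (fun z => f z.1 + f z.2).
      by apply/funext => z; exact: linearD.
    rewrite -[X in X --> _]/((fun z : weak_topology * weak_topology =>
      f ((z.1 : V) + z.2)) @ x) fE linearD.
    apply: (@cvgD _ R[i]^o _ _ _ (fun z : weak_topology * weak_topology => f z.1)
      (fun z => f z.2)).
      by apply: cvg_comp; [exact: cvg_fst | exact: weak_continuous].
    by apply: cvg_comp; [exact: cvg_snd | exact: weak_continuous].
  exact: compact_setX.
Qed.

End PolarTopology.

Definition strong_dual {R : realType} (V : topologicalLmodType R[i]) : Type :=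
  dual V.

Definition mackey_dual {R : realType} (V : topologicalLmodType R[i]) : Type :=
  dual V.

Section StrongMackey.
Context {R : realType} (V : topologicalLmodType R[i]).

Let bounded0 : [set D : set V | bounded_in D] !=set0.
Proof. by exists set0 => U _; exists 1. Qed.

Let bounded_dir (D E : set V) : bounded_in D -> bounded_in E ->
  exists2 F : set V, bounded_in F & D `|` E `<=` F.
Proof. by move=> bD bE; exists (D `|` E) => //; exact: bounded_inU. Qed.

HB.instance Definition _ := Choice.on (strong_dual V).
HB.instance Definition _ := isOpenTopological.Build (strong_dual V)
  (polar_openT bounded0) (polar_openI bounded_dir) (@polar_open_bigU _ _ _).

Let mackey0 : @mackey_family R V !=set0.
Proof.
exists set0; split=> [a v _ []|x y l|].
  by move=> /set_mem.
exact: compact0.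
Qed.

HB.instance Definition _ := Choice.on (mackey_dual V).
HB.instance Definition _ := isOpenTopological.Build (mackey_dual V)
  (polar_openT mackey0) (polar_openI (@mackey_family_dir R V))
  (@polar_open_bigU _ _ _).

Let polar_open_nbhs0 (S : set_system V) (U : set (dual V)) :
  (exists A, [/\ polar_open S A, A 0 & A `<=` U]) <->
  exists D e, [/\ S D, 0 < e & polar D e `<=` U].
Proof.
split=> [[A [oA A0 AU]]|[D [e [SD e0 DU]]]].
  have [D [e [SD e0 De]]] := oA _ A0; exists D, e; split=> // g /De.
  by rewrite add0r => /AU.
by exists (polar D e); split=> //; [exact: polar_open_polar | exact: polar0].
Qed.

Lemma strong_nbhs0 (U : set (strong_dual V)) :
  nbhs ((0 : dual V) : strong_dual V) U <->
  exists D e, [/\ bounded_in D, 0 < e & polar D e `<=` U].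
Proof.
rewrite -polar_open_nbhs0 nbhsE; split=> [[A [oA A0] AU]|[A [oA A0 AU]]].
  by exists A.
by exists A.
Qed.

Lemma mackey_nbhs0 (U : set (mackey_dual V)) :
  nbhs ((0 : dual V) : mackey_dual V) U <->
  exists D e, [/\ mackey_family D, 0 < e & polar D e `<=` U].
Proof.
rewrite -polar_open_nbhs0 nbhsE; split=> [[A [oA A0] AU]|[A [oA A0 AU]]].
  by exists A.
by exists A.
Qed.

End StrongMackey.

Section NormedDual.
Context {R : realType} (W : normedModType R[i]).

Definition opnorm (f : dual W) : R :=
  sup [set normc (f w) | w in [set w : W | `|w| <= 1]].

Lemma opnorm_has_sup (f : dual W) :
  has_sup [set normc (f w) | w in [set w : W | `|w| <= 1]].
Proof.
split; first by exists (normc (f 0)), 0; rewrite //= normr0.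
have /linear_bounded_continuous/linear_boundedP/pinfty_ex_gt0 [r r0 fr] :=
  @dual_continuous _ _ f.
exists (complex.Re r) => _ [w w1 <-].
rewrite -lecR RRe_real ?gtr0_real//; apply: le_trans (fr w) _.
by rewrite ger_pMr.
Qed.

Lemma opnorm_ub (f : dual W) w : `|w| <= 1 -> normc (f w) <= opnorm f.
Proof.
move=> w1; apply: sup_upper_bound; first exact: opnorm_has_sup.
by exists w.
Qed.

Lemma opnorm_le (f : dual W) r :
  (forall w : W, `|w| <= 1 -> normc (f w) <= r) -> opnorm f <= r.
Proof.
move=> fr; apply: ge_sup; first by case: (opnorm_has_sup f).
by move=> _ [w w1 <-]; exact: fr.
Qed.

Let dual_normD (f g : dual W) :
  (opnorm (f + g))%:C <= (opnorm f)%:C + (opnorm g)%:C.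
Proof.
rewrite -rmorphD lecR; apply: opnorm_le => w w1.
rewrite (le_trans (normc_ler_norm _ _))// lerD//; exact: opnorm_ub.
Qed.

Let opnormZ_le (a : R[i]) (f : dual W) :
  opnorm (a *: f) <= normc a * opnorm f.
Proof.
apply: opnorm_le => w w1; have -> : (a *: f) w = a * f w by [].
rewrite normcM.
by rewrite ler_wpM2l ?opnorm_ub// normc_ge0.
Qed.

Let dual_normZ (a : R[i]) (f : dual W) :
  (opnorm (a *: f))%:C = `|a| * (opnorm f)%:C.
Proof.
rewrite -[ `|a| ]/((normc a)%:C) -rmorphM; congr (_%:C).
apply/le_anti; rewrite opnormZ_le /=.
have [->|a0] := eqVneq a 0.
  rewrite normc0 mul0r; apply: le_trans (opnorm_ub _ (w := 0) _).
    exact: normc_ge0.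
  by rewrite normr0.
have na0 : 0 < normc a.
  rewrite lt_neqAle eq_sym; apply/andP; split.
    by apply: contra a0 => /eqP /eq0_normc ->.
  exact: normc_ge0.
rewrite -ler_pdivlMl//; have := opnormZ_le a^-1 (a *: f).
by rewrite scalerA mulVf// scale1r normcV.
Qed.

Let dual_norm0_eq0 (f : dual W) : (opnorm f)%:C = 0 :> R[i] -> f = 0.
Proof.
move=> /(@complexI R) f0; apply: val_inj; apply/funext => w /=.
have [->|w0] := eqVneq w 0; first by rewrite linear0.
have nw0 : `|w| != 0 by rewrite normr_eq0.
suff : f (`|w|^-1 *: w) = 0.
  by rewrite linearZ /= => /eqP; rewrite mulf_eq0 invr_eq0 (negPf nw0) => /eqP.
apply: eq0_normc; apply/le_anti; rewrite normc_ge0 andbT -f0.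
by apply: opnorm_ub; rewrite normrZ normfV normr_id mulVf.
Qed.

HB.instance Definition _ := Lmodule_isNormed.Build R[i] (dual W)
  dual_normD dual_normZ dual_norm0_eq0.

End NormedDual.

Section CountablyNormed.
Context {R : realType}.

Record is_norm (E : lmodType R[i]) (N : E -> R) : Prop := IsNorm {
  is_normD : forall u v, N (u + v) <= N u + N v ;
  is_normZ : forall (a : R[i]) v, N (a *: v) = normc a * N v ;
  is_norm0_eq0 : forall v, N v = 0 -> v = 0 }.

Definition inner_product_norm (E : lmodType R[i]) (N : E -> R) : Prop :=
  is_norm N /\
  exists dot : {dot E for conjc}, forall v, dot v v = ((N v) ^+ 2)%:C.

Definition is_completion (E : lmodType R[i]) (N : E -> R)
    (W : completeNormedModType R[i]) (iota : {linear E -> W}) : Prop :=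
  (forall v, `|iota v| = (N v)%:C) /\ dense (range iota).

Definition tvs_complete (V : topologicalLmodType R[i]) : Prop :=
  forall F : set_system V, ProperFilter F ->
    x.1 - x.2 @[x --> (F, F)] --> (0 : V) -> exists l : V, F --> l.

(* The norms |.|_1, |.|_2, ... are indexed from 0. *)
Record countably_normed (V : topologicalLmodType R[i]) (nrm : nat -> V -> R)
    : Prop := CountablyNormed {
  countably_normed_norm : forall n, is_norm (nrm n) ;
  countably_normed_nbhs : forall x : V,
    nbhs x = filter_from [set p : nat * R | 0 < p.2]
      (fun p => [set y | forall k, (k <= p.1)%N -> nrm k (y - x) < p.2]) }.

Record countably_hilbert (V : topologicalLmodType R[i]) (nrm : nat -> V -> R)
    : Prop := CountablyHilbert {
  countably_hilbert_normed : countably_normed nrm ;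
  countably_hilbert_inner : forall n, inner_product_norm (nrm n) ;
  countably_hilbert_complete : tvs_complete V }.

End CountablyNormed.

Section Restriction.
Context {R : realType} {V : topologicalLmodType R[i]}.

Lemma completion_continuous (nrm : nat -> V -> R) n
    (W : completeNormedModType R[i]) (iota : {linear V -> W}) :
  countably_normed nrm -> is_completion (nrm n) iota -> continuous iota.
Proof.
move=> [_ nbhsV] [isom _] x; apply/cvgrPdist_lt => e e0.
suff : nbhs x [set y | `|iota x - iota y| < e] by [].
rewrite nbhsV /=; exists (n, complex.Re e) => /=.
  by rewrite -ltcR RRe_real ?gtr0_real.
move=> y /(_ n (leqnn n)) yx /=.
by rewrite distrC -linearB isom -[ltRHS]RRe_real ?gtr0_real// ltcR.
Qed.

Context {W : completeNormedModType R[i]} {iota : {linear V -> W}}.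
Hypothesis iota_cont : continuous iota.

Lemma restr_subproof (f : dual W) : (f \o iota) \in @dual_pred _ V.
Proof.
have /asboolP[_ cf] := dual_funP f; apply/asboolP; split.
  by move=> a u v; rewrite /= !linearP.
by move=> x; apply: continuous_comp; [exact: iota_cont | exact: cf].
Qed.

Definition restr (f : dual W) : dual V := Dual (restr_subproof f).

End Restriction.

Definition lcv_topology {R : realType} {E : lmodType R[i]}
    (T : Topological E) : Prop :=
  let ET := Topological.Pack T in
  [/\ continuous (fun x : ET * ET => (x.1 : E) + (x.2 : E) : ET),
      continuous (fun z : R[i]^o * ET => (z.1 : R[i]) *: (z.2 : E) : ET) &
      exists2 B : set_system ET,
        (forall b, b \in B -> convex_set (b : set E)) & basis B].

(* The finest among the topologies [T] on the dual that are locally convex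
   vector topologies and make every V_n' -> V' continuous is presented as the
   one generated by the open sets of all such [T]. It is itself such a
   topology ([inductive_dual_admissible]) and finer than all of them
   ([inductive_dual_finest]). *)
Definition inductive_dual {R : realType} {V : topologicalLmodType R[i]}
    {W : nat -> completeNormedModType R[i]}
    {iota : forall n, {linear V -> W n}}
    (iota_cont : forall n, continuous (iota n)) : Type := dual V.

Section InductiveLimit.
Context {R : realType} {V : topologicalLmodType R[i]}.
Context {W : nat -> completeNormedModType R[i]}.
Context {iota : forall n, {linear V -> W n}}.
Hypothesis iota_cont : forall n, continuous (iota n).

Definition inductive_admissible (T : Topological (dual V)) : Prop :=
  lcv_topology T /\ forall n,
    continuous (restr (@iota_cont n) : dual (W n) -> Topological.Pack T).

Definition inductive_subbase : set_system (dual V) :=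
  [set U : set (dual V) | exists2 T, inductive_admissible T
    & @open (Topological.Pack T) U].

HB.instance Definition _ := Choice.on (inductive_dual iota_cont).
HB.instance Definition _ :=
  isSubBaseTopological.Build (inductive_dual iota_cont) inductive_subbase id.

Local Notation inductive_dual := (inductive_dual iota_cont).

Lemma cvg_inductive (F : set_system (dual V)) (x : dual V) : Filter F ->
  (forall T, inductive_admissible T -> F --> (x : Topological.Pack T)) ->
  F --> (x : inductive_dual).
Proof.
move=> FF Fx A; rewrite (@nbhsE inductive_dual).
move=> [_ [[B sB <-] [C BC Cx] sUBA]].
apply: filterS sUBA _; apply: (@filterS _ _ _ C); first by move=> ? ?; exists C.
have /sB [D sD IDeC] := BC; rewrite -IDeC; apply: filter_bigI => E DE.
have /sD := DE; rewrite inE => -[T aT oE]; apply: (Fx T aT).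
apply: open_nbhs_nbhs; split=> //.
by move: Cx; rewrite -IDeC => /(_ _ DE).
Qed.

Lemma inductive_dual_finest (T : Topological (dual V)) :
  inductive_admissible T ->
  @open (Topological.Pack T) `<=` @open inductive_dual.
Proof.
move=> aT A oA; exists [set A]; last by rewrite bigcup_set1.
move=> _ ->; exists [fset A]%fset; last by rewrite set_fset1 bigcap_set1.
by move=> E; rewrite inE inE => /eqP ->; exists T.
Qed.

Let nbhs_inductive (T : Topological (dual V)) (x : dual V) :
  inductive_admissible T ->
  nbhs (x : Topological.Pack T) `<=` nbhs (x : inductive_dual).
Proof.
move=> aT A; rewrite (@nbhsE (Topological.Pack T)) => -[B [oB Bx] BA].
rewrite (@nbhsE inductive_dual); exists B => //; split=> //.
exact: (inductive_dual_finest aT).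
Qed.

Lemma inductive_dual_admissible :
  inductive_admissible (Topological.class inductive_dual).
Proof.
split; first split.
- move=> x; apply: cvg_inductive => T aT U /=.
  have [[addT _ _] _] := aT.
  move=> /(addT x)[[A B] /= [xA xB] AB]; exists (A, B) => //=.
  by split; exact: (nbhs_inductive aT).
- move=> z; apply: cvg_inductive => T aT U /=.
  have [[_ scaleT _] _] := aT.
  move=> /(scaleT z)[[A B] /= [zA zB] AB]; exists (A, B) => //=.
  by split=> //; exact: (nbhs_inductive aT).
- exists [set b | @open inductive_dual b /\ convex_set (b : set (dual V))].
    by move=> b /set_mem[].
  split=> [b []//|x].
  apply: cvg_inductive.
    apply: filter_from_filter.
      exists setT; split=> //; split; first exact: openT.
      by move=> u v l _ _; exact/mem_set.
    move=> A B [[oA cA] Ax] [[oB cB] Bx]; exists (A `&` B) => //.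
    do 2!split=> //; first exact: openI.
    move=> u v l /set_mem[Au Bu] /set_mem[Av Bv]; apply/mem_set; split.
      by apply/set_mem/cA; exact/mem_set.
    by apply/set_mem/cB; exact/mem_set.
  move=> T aT U /=; have [[_ _ [B cB [oB nB]]] _] := aT.
  move=> /nB[b /= [Bb bx] bU]; exists b => //=; split=> //; split.
    exact: (inductive_dual_finest aT (oB _ Bb)).
  by apply: cB; exact/mem_set.
- move=> n f; apply: cvg_inductive => [|T [_ /(_ n f)]]; last exact.
  exact: (fmap_filter _ (nbhs_filter f)).
Qed.

End InductiveLimit.

(* Main.v *)
(** Write |.|_k for the norms and, for weights a_k > 0, q_n = sum_(k < n) a_k |.|_k^2,
    again a Hilbert seminorm. By the parallelogram law almost minimizers of the q_n on
    a directed family of closed convex sets form a Cauchy filter, so by completeness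
    such a family has a common point v with sup_n q_n v <= 1 as soon as each member
    meets every {q_n <= 1}. Applied to {g = 1} this shows that a functional g with
    |g| < 1 on the ellipsoid K = {v | sup_n q_n v <= 1} already satisfies |g|^2 <= q_n
    for some n; by Riesz g is then a combination of functionals <., u>_k for k < n,
    which puts it in any given convex inductive neighborhood of 0 if the a_k are small.
    Hence inductive <= strong. Applied to the closed convex members of an ultrafilter,
    the same common point shows that K is weakly compact; since every bounded set lies
    in such a K, strong <= Mackey. Conversely weakly compact sets are bounded by the
    uniform boundedness principle (Mackey <= strong), and the strong topology is
    locally convex with continuous inclusions of the V_n' (strong <= inductive). *)
Require Import Defs.
From mathcomp Require Import all_boot all_order all_algebra.
From mathcomp Require Import complex ring lra.
From mathcomp Require Import all_classical all_reals all_analysis.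

Set Implicit Arguments.
Unset Strict Implicit.
Unset Printing Implicit Defensive.

Import Order.TTheory GRing.Theory Num.Theory.
Import numFieldNormedType.Exports.
Import Normc.

Local Open Scope classical_set_scope.
Local Open Scope ring_scope.
Local Open Scope complex_scope.

(** * The complex modulus, a quadratic inequality, and limits of filters in a disc *)

Section ComplexModulus.
Context {R : realType}.
Implicit Types (x y z : R[i]) (r : R).

Lemma normcR r : 0 <= r -> normc (r%:C) = r.
Proof. by move=> r0; rewrite /= expr0n addr0 sqrtr_sqr ger0_norm. Qed.

Lemma normc_norm x : `|x| = (normc x)%:C.
Proof. by []. Qed.

Lemma normc_opp x : normc (- x) = normc x.
Proof. by case: x => a b; rewrite /= !sqrrN. Qed.

Lemma normc_sub x y : normc (x - y) = normc (y - x).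
Proof. by rewrite -normc_opp opprB. Qed.

Lemma normc_conj x : normc (x^*) = normc x.
Proof. by case: x => a b; rewrite /= sqrrN. Qed.

Lemma sqr_normc_Re x : (normc x ^+ 2)%:C = x * x^*.
Proof. by rewrite -sqr_normc normc_norm rmorphXn. Qed.

Lemma Re_le_normc x : `|complex.Re x| <= normc x.
Proof. by rewrite -lecR; exact: normc_ge_Re. Qed.

Lemma Im_le_normc x : `|complex.Im x| <= normc x.
Proof.
by case: x => a b /=; rewrite -sqrtr_sqr ler_sqrt ?addr_ge0 ?sqr_ge0// lerDr sqr_ge0.
Qed.

Lemma normc_le_ReIm x : normc x <= `|complex.Re x| + `|complex.Im x|.
Proof.
case: x => a b /=.
rewrite -[leRHS](ger0_norm (addr_ge0 (normr_ge0 _) (normr_ge0 _))).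
rewrite -[leRHS]sqrtr_sqr ler_sqrt ?sqr_ge0//.
rewrite -(real_normK (num_real a)) -(real_normK (num_real b)).
have := normr_ge0 a; have := normr_ge0 b; nra.
Qed.

(* For [t = - s * z^*] with [s >= 0] the hypothesis is a quadratic inequality
   in [s]. *)
Lemma normc_sqr_le_of_ge0 (d Q : R) z : 0 <= d -> 0 <= Q ->
  (forall t, 0 <= d + 2 * complex.Re (t * z) + normc t ^+ 2 * Q) ->
  normc z ^+ 2 <= d * Q.
Proof.
move=> d0 Q0 H.
have key s : 0 <= s -> 0 <= d - 2 * s * normc z ^+ 2 + s ^+ 2 * normc z ^+ 2 * Q.
  move=> s0; have := H (- (s%:C * z^*)).
  rewrite normc_opp normcM normc_conj (normcR s0) exprMn.
  have -> : - (s%:C * z^*) * z = (- (s * normc z ^+ 2))%:C.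
    rewrite mulNr -mulrA (mulrC _ z) -sqr_normc_Re. by rewrite -rmorphM -rmorphN.
  by rewrite /= ; nra.
have Z0 : 0 <= normc z ^+ 2 by exact: sqr_ge0.
move: (normc z ^+ 2) Z0 key => Z Z0 key.
(* The optimal [s] is [Q^-1]. When [Q = 0] the expression is affine in [s], and for [Z > 0] it is
   negative at [d / Z + 1]. *)
have [QE|Qn0] := eqVneq Q 0.
  subst Q; rewrite mulr0 leNgt; apply/negP => Zp.
  have := key (d / Z + 1); rewrite addr_ge0 ?divr_ge0// => /(_ isT).
  have -> : d - 2 * (d / Z + 1) * Z + (d / Z + 1) ^+ 2 * Z * 0 = - d - 2 * Z.
    by field; rewrite gt_eqF.
  by lra.
have Qp : 0 < Q by rewrite lt_neqAle eq_sym Qn0.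
have := key Q^-1; rewrite invr_ge0 => /(_ Q0).
have -> : d - 2 * Q^-1 * Z + Q^-1 ^+ 2 * Z * Q = d - Z / Q by field.
by rewrite subr_ge0 ler_pdivrMr.
Qed.

(** The initial disc lies in the image under [h] of a compact square, so the filter has a cluster
    point, and a cluster point cannot leave a closed disc of the filter. This yields values of limit
    functionals together with explicit error bounds. *)
Lemma filter_closed_ball (F : set_system R[i]^o) (x0 : R[i]) (r0 : R) :
  ProperFilter F -> F [set y | normc (y - x0) <= r0] ->
  exists z, forall x r, F [set y | normc (y - x) <= r] -> normc (z - x) <= r.
Proof.
move=> FF; case: x0 => a b F0.
pose h (p : R * R) : R[i]^o := p.1 +i* p.2.
have hc : continuous h.
  move=> [u v]; apply/cvgrPdist_lt => e e0.
  pose e' := complex.Re e.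
  have eE : e = e'%:C by rewrite /e' RRe_real// gtr0_real.
  have e'0 : 0 < e' by rewrite -ltcR -eE.
  have e20 : 0 < e' / 2 by rewrite divr_gt0.
  exists (ball u (e' / 2), ball v (e' / 2)).
    by split; exact: nbhsx_ballx.
  move=> [c d] [/= ac bd]; rewrite normc_norm eE ltcR.
  apply: le_lt_trans (normc_le_ReIm _) _ => /=.
  by rewrite (splitr e') ltrD.
have kK : compact (h @` (`[a - r0, a + r0]%classic `*` `[b - r0, b + r0]%classic)).
  apply: continuous_compact; first exact: continuous_subspaceT.
  by apply: compact_setX; exact: segment_compact.
have [z [_ zc]] : h @` (`[a - r0, a + r0]%classic `*` `[b - r0, b + r0]%classic)
    `&` cluster F !=set0.
  apply: kK; apply: filterS F0 => -[c d] cd; exists (c, d) => //.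
  have := le_trans (Re_le_normc _) cd; have := le_trans (Im_le_normc _) cd.
  rewrite /= !ler_distl => /andP[? ?] /andP[? ?].
  by split; rewrite /= in_itv /=; apply/andP; split; lra.
(* If [z] lay outside the disc, the ball about [z] of radius [normc (z - x) - r] would miss it. *)
exists z => x r Fx; rewrite leNgt; apply/negP => zr.
have d0 : 0 < (normc (z - x) - r)%:C :> R[i] by rewrite (ltcR 0) subr_gt0.
have [y [yx yz]] := zc _ (ball (z : R[i]^o) (normc (z - x) - r)%:C) Fx
  (nbhsx_ballx _ _ d0).
move: yz; rewrite -ball_normE /= normc_norm ltcR => yz.
have := normc_ler_norm (z - y) (y - x); rewrite addrA subrK.
move: yx zr yz => /=; lra.
Qed.

End ComplexModulus.

(** * Positive semidefinite Hermitian forms and approximate Riesz representation *)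

Section HermitianForm.
Context {R : realType} {E : lmodType R[i]}.
Implicit Types (q : E -> R) (B : E -> E -> R[i]).

(** Only semidefiniteness is asked, so that weighted finite sums of squared norms qualify, the empty
    sum included. *)
Definition quadratic_form_of B q : Prop :=
  [/\ forall v, linear (fun u => B u v : R[i]^o), forall u v, B v u = (B u v)^*,
      forall v, B v v = (q v)%:C & forall v, 0 <= q v].

Lemma quadratic_formD B q u y t : quadratic_form_of B q ->
  q (u + t *: y) = q u + 2 * complex.Re (t * B y u) + normc t ^+ 2 * q y.
Proof.
move=> [lB hB Bq _]; have BD w v x a : B (a *: w + v) x = a * B w x + B v x.
  exact: (lB x).
apply: (@complexI R); rewrite -Bq addrC BD (hB (t *: y + u)) (hB (t *: y + u)).
have -> : (q u + 2 * complex.Re (t * B y u) + normc t ^+ 2 * q y)%:C =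
    (q u)%:C + (2 * complex.Re (t * B y u))%:C + t * t^* * (q y)%:C.
  by rewrite -sqr_normc_Re -rmorphM -!rmorphD.
rewrite !BD !Bq (hB y u); case: t => a b; case: (B y u) => c d.
by apply/eqP; rewrite eq_complex /=; apply/andP; split; apply/eqP; ring.
Qed.

Lemma quadratic_formZ B q t y : quadratic_form_of B q ->
  q (t *: y) = normc t ^+ 2 * q y.
Proof.
move=> Bq; have [lB hB BE _] := Bq; have B0 v : B 0 v = 0.
  by have := lB v (-1) 0 0; rewrite scaler0 addr0 => ->; rewrite scaleN1r addNr.
have q0 : q 0 = 0 by apply: (@complexI R); rewrite -BE.
by have := quadratic_formD 0 y t Bq; rewrite hB B0 rmorph0 mulr0 q0 mulr0 !add0r.
Qed.

Lemma quadratic_form_parallelogram B q u v : quadratic_form_of B q ->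
  q (u + v) + q (u - v) = 2 * q u + 2 * q v.
Proof.
move=> Bq; have := quadratic_formD u v 1 Bq; have := quadratic_formD u v (-1) Bq.
have n1 : normc (1 : R[i]) = 1 by exact: normc1.
rewrite scaleN1r scale1r !normc_opp !n1 => -> ->.
by rewrite mulN1r mul1r; case: (B v u) => a b /=; ring.
Qed.

(** Along the segment from [v] to [u], [q] is a quadratic polynomial in [t] with leading coefficient
    [q (u - v) >= 0], and [t ^+ 2 <= t] on the unit interval. *)
Lemma quadratic_form_convex B q u v (t : R) : quadratic_form_of B q ->
  0 <= t <= 1 -> q (t%:C *: u + (1 - t%:C) *: v) <= t * q u + (1 - t) * q v.
Proof.
move=> Bq /andP[t0 t1]; have [_ _ _ q0] := Bq.
have n1 : normc (1 : R[i]) = 1 by exact: normc1.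
have := quadratic_formD v (u - v) t%:C Bq; have := quadratic_formD v (u - v) 1 Bq.
rewrite n1 normcR// scale1r addrC subrK mul1r => qu.
have -> : v + t%:C *: (u - v) = t%:C *: u + (1 - t%:C) *: v.
  by rewrite scalerBr scalerBl scale1r addrCA.
move=> ->; have := q0 (u - v); move: qu.
have -> : complex.Re (t%:C * B (u - v) v) = t * complex.Re (B (u - v) v).
  by case: (B _ _) => x y /=; rewrite mul0r subr0.
move=> -> D0; have : t ^+ 2 * q (u - v) <= t * q (u - v).
  by apply: ler_wpM2r => //; rewrite expr2; nra.
lra.
Qed.

Lemma quadratic_form_CauchySchwarz B q u y : quadratic_form_of B q ->
  normc (B y u) ^+ 2 <= q u * q y.
Proof.
move=> Bq; have [_ _ _ q0] := Bq; apply: normc_sqr_le_of_ge0 => // t.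
by rewrite -(quadratic_formD _ _ _ Bq).
Qed.

Lemma quadratic_form_sum (a : nat -> R) (B : nat -> E -> E -> R[i])
    (q : nat -> E -> R) n : (forall k, 0 <= a k) ->
  (forall k, quadratic_form_of (B k) (q k)) ->
  quadratic_form_of (fun u v => \sum_(k < n) (a k)%:C * B k u v)
    (fun v => \sum_(k < n) a k * q k v).
Proof.
move=> a0 Bq; split.
- move=> v c x y; rewrite scaler_sumr -big_split; apply: eq_bigr => k _ /=.
  have [lB _ _ _] := Bq k; rewrite lB.
  rewrite mulrDr; congr (_ + _); exact: mulrCA.
- move=> u v; rewrite rmorph_sum; apply: eq_bigr => k _.
  by have [_ hB _ _] := Bq k; rewrite rmorphM hB /= oppr0.
- move=> v; rewrite rmorph_sum; apply: eq_bigr => k _.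
  by have [_ _ -> _] := Bq k; rewrite rmorphM.
- by move=> v; apply: sumr_ge0 => k _; have [_ _ _ ?] := Bq k; apply: mulr_ge0.
Qed.

(* Approximate Riesz representation: [u] almost minimizes
   [fun v => q v - 2 * Re (g v)]. *)
Lemma quadratic_form_Riesz B q (g : E -> R[i]) (d : R) :
  quadratic_form_of B q -> linear (g : E -> R[i]^o) ->
  (forall v, normc (g v) ^+ 2 <= q v) -> 0 < d ->
  exists2 u, q u <= 4 & forall y, normc (g y - B y u) ^+ 2 <= d * q y.
Proof.
move=> Bq lg gq d0; have [lB _ BE q0] := Bq.
pose J v := q v - 2 * complex.Re (g v).
have JN1 v : -1 <= J v.
  have := gq v; have := Re_le_normc (g v); rewrite ler_norml => /andP[_].
  rewrite /J; have := normc_ge0 (g v); have := sqr_ge0 (normc (g v) - 1); nra.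
have infJ : has_inf (range J).
  by split; [exists (J 0), 0 | exists (-1) => _ [v _ <-]].
(* The bound [d] serves the error estimate, the bound 1 serves [q u <= 4]. *)
pose e := Num.min d 1.
have e0 : 0 < e by rewrite lt_min d0 ltr01.
have [_ [u _ <-] Ju] := inf_adherent e0 infJ.
(* Near minimality gives [J (u + t *: y) - J u + e >= 0] for all [t]; this is the quadratic
   inequality for [z = B y u - g y]. *)
have key y : normc (g y - B y u) ^+ 2 <= e * q y.
  rewrite normc_sub; apply: normc_sqr_le_of_ge0; rewrite ?(ltW e0)// => t.
  have : inf (range J) <= J (u + t *: y).
    by apply: ge_inf; [case: infJ | exists (u + t *: y)].
  rewrite /J (quadratic_formD _ _ _ Bq) [u + _]addrC lg.
  have -> : t *: (g y : R[i]^o) = t * g y by [].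
  rewrite mulrBr !raddfD raddfN /=; move: Ju; rewrite /J; lra.
exists u => [|y]; last first.
  by apply: le_trans (key y) _; rewrite ler_wpM2r// /e ge_min lexx.
have e1 : e <= 1 by rewrite /e ge_min lexx orbT.
(* For [Q = q u], [s = normc (g u)] and [r] the error at [u]: [Q ^+ 2 <= (s + r) ^+ 2 <= 2 * (s ^+ 2
   + r ^+ 2) <= 4 * Q]. *)
have aux (r s Q : R) : 0 <= Q -> 0 <= r -> 0 <= s -> Q <= s + r ->
    s ^+ 2 <= Q -> r ^+ 2 <= e * Q -> Q <= 4.
  move=> Q0 r0 s0 Qrs sQ rQ.
  have [->//|Qn0] := eqVneq Q 0.
  have Qp : 0 < Q by rewrite lt_neqAle eq_sym Qn0.
  rewrite -(ler_pM2l Qp).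
  have : Q * Q <= (s + r) * (s + r) by rewrite ler_pM.
  have := sqr_ge0 (s - r).
  have : e * Q <= Q by rewrite ger_pMl.
  lra.
apply: (aux (normc (g u - (q u)%:C)) (normc (g u))) => //;
  try exact: normc_ge0.
  have := normc_ler_norm (g u) ((q u)%:C - g u).
  by rewrite addrC subrK (normcR (q0 u)) (normc_sub _ (g u)).
by rewrite -BE.
Qed.

Lemma inner_product_quadratic_form (N : E -> R) : inner_product_norm N ->
  exists B, quadratic_form_of B (fun v => N v ^+ 2).
Proof.
move=> [_ [dot dotE]]; exists dot; split=> //.
- by move=> v a x y; rewrite linearPl.
- by move=> u v; rewrite hermC /= mul1r.
- by move=> v; exact: sqr_ge0.
Qed.
End HermitianForm.

(** * Norms, and continuity of functionals bounded by them *)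

Section Norms.
Context {R : realType} {E : lmodType R[i]} (N : E -> R) (hN : is_norm N).

Lemma is_normN v : N (- v) = N v.
Proof.
have n1 : normc (1 : R[i]) = 1 by exact: normc1.
by have := is_normZ hN (-1) v; rewrite scaleN1r normc_opp n1 mul1r.
Qed.

Lemma is_norm0 : N 0 = 0.
Proof. by have := is_normZ hN 0 0; rewrite scale0r normc0 mul0r. Qed.

Lemma is_norm_ge0 v : 0 <= N v.
Proof. by have := is_normD hN v (- v); rewrite subrr is_norm0 is_normN; lra. Qed.

Lemma is_norm_dist u v : `|N u - N v| <= N (u - v).
Proof.
have := is_normD hN (u - v) v; have := is_normD hN (v - u) u.
rewrite !subrK -opprB is_normN ler_norml; lra.
Qed.

End Norms.

(** Of [p] only its balls matter, so that the lemma applies both to [nrm n] on [V] and to the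
    real-valued norm of a completion. *)
Lemma linear_bound_dual {R : realType} (X : topologicalLmodType R[i])
    (p : X -> R) (c : R) (f : X -> R[i]^o) :
  (forall (x : X) (e : R), 0 < e -> nbhs x [set y | p (y - x) < e]) ->
  0 <= c -> linear f -> (forall v, normc (f v) <= c * p v) -> f \in @dual_pred _ X.
Proof.
move=> pc c0 lf fc; apply/asboolP; split=> // x; apply/cvgrPdist_lt => e e0.
have eE : e = (complex.Re e)%:C by rewrite RRe_real// gtr0_real.
rewrite eE (ltcR 0) in e0; rewrite eE; move: (complex.Re e) e0 => r r0.
(* [c + 1] replaces [c] as a divisor because [c] may be 0. *)
have c10 : 0 < c + 1 by rewrite ltr_wpDl.
near=> y; rewrite distrC.
have -> : f y - f x = f (y - x).
  by rewrite [y - x]addrC -[- x]scaleN1r lf scaleN1r addrC.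
rewrite normc_norm ltcR; apply: le_lt_trans (fc _) _.
apply: (@le_lt_trans _ _ (c * (r / (c + 1)))).
  by apply: ler_wpM2l => //; apply: ltW; near: y; apply: pc; exact: divr_gt0.
by rewrite mulrCA gtr_pMr// ltr_pdivrMr// mul1r ltrDl.
Unshelve. all: by end_near. Qed.

(** * Neighborhoods, functionals and bounded sets in a countably-normed space *)

Section CountablyNormedSpace.
Context {R : realType} {V : topologicalLmodType R[i]} {nrm : nat -> V -> R}.
Hypothesis hV : countably_normed nrm.
Hypothesis nrm_mono : forall n (v : V), nrm n v <= nrm n.+1 v.

Let nrm_norm n : is_norm (nrm n) := countably_normed_norm hV n.
Let nrm_ge0 n v : 0 <= nrm n v := is_norm_ge0 (nrm_norm n) v.

Lemma nrm_le k n v : (k <= n)%N -> nrm k v <= nrm n v.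
Proof.
move=> /subnK <-; elim: (n - k)%N => // m IH; rewrite addSn.
exact: le_trans IH _.
Qed.

Lemma nbhs_nrm_lt n (x : V) (e : R) : 0 < e ->
  nbhs x [set y | nrm n (y - x) < e].
Proof.
by move=> e0; rewrite (countably_normed_nbhs hV); exists (n, e) => //= y; apply.
Qed.

(** Since the norms increase, the condition on the last norm implies those on all earlier ones. *)
Lemma nbhs_nrmP (x : V) (U : set V) : nbhs x U ->
  exists n (e : R), 0 < e /\ forall y, nrm n (y - x) < e -> U y.
Proof.
rewrite (countably_normed_nbhs hV) => -[[n e] /= e0 nU]; exists n, e; split=> //.
by move=> y yx; apply: nU => k kn; apply: le_lt_trans yx; exact: nrm_le.
Qed.

Lemma nrm_continuous n : continuous (nrm n).
Proof.
move=> x; apply/cvgrPdist_lt => e e0; near=> y.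
apply: le_lt_trans (is_norm_dist (nrm_norm n) _ _) _.
rewrite -opprB (is_normN (nrm_norm n)).
by near: y; exact: nbhs_nrm_lt.
Unshelve. all: by end_near. Qed.

Lemma nrm_bounded_dual n (c : R) (f : V -> R[i]^o) : 0 <= c ->
  linear f -> (forall v, normc (f v) <= c * nrm n v) -> f \in @dual_pred _ V.
Proof. by apply: linear_bound_dual => x e; exact: nbhs_nrm_lt. Qed.

(** This is the fact that V' is the union of the V_n'. *)
Lemma dual_nrm_bounded (f : dual V) :
  exists n (c : R), 0 <= c /\ forall v, normc (f v) <= c * nrm n v.
Proof.
have /cvgrPdist_lt/(_ 1 ltr01) := @dual_continuous _ _ f 0.
move=> /nbhs_nrmP[n [e [e0 ef]]]; exists n, (2 / e); split.
  by rewrite divr_ge0// ltW.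
move=> v; have {}ef w : nrm n w < e -> normc (f w) < 1.
  by move=> we; have := ef w; rewrite subr0 linear0 sub0r normrN normc_norm ltcR; apply.
(* Scaling by [e / r] moves [v] into the open ball of radius [e]. The strict inequality is met by
   [r = 2 * nrm n v], whence the constant [2 / e]. *)
have key (r : R) : 0 < r -> nrm n v < r -> normc (f v) <= r / e.
  move=> r0 vr; have re0 : 0 < e / r by rewrite divr_gt0.
  have := ef ((e / r)%:C *: v); rewrite (is_normZ (nrm_norm n)).
  have -> : f ((e / r)%:C *: v) = (e / r)%:C * f v by rewrite linearZ.
  rewrite normcM normcR; last exact: ltW.
  have ve : e / r * nrm n v < e by rewrite mulrAC ltr_pdivrMr// ltr_pM2l.
  by move=> /(_ ve); rewrite mulrAC ltr_pdivrMr// mul1r ler_pdivlMr// mulrC => /ltW.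
have [v0|vn0] := eqVneq (nrm n v) 0.
  rewrite (is_norm0_eq0 (nrm_norm n) v0) linear0 normc0.
  by rewrite (is_norm0 (nrm_norm n)) mulr0.
have vp : 0 < nrm n v by rewrite lt_neqAle eq_sym vn0 /=.
by rewrite mulrAC; apply: key; move: vp; lra.
Qed.

Lemma bounded_inP (D : set V) :
  bounded_in D <-> forall n, exists M : R, forall v, D v -> nrm n v <= M.
Proof.
split=> [bD n|bD U /nbhs_nrmP[n [e [e0 eU]]]].
  have [l l0 lD] := bD _ (nbhs_nrm_lt n 0 ltr01).
  exists (normc l) => _ /lD[u + <-]; rewrite /= subr0 (is_normZ (nrm_norm n)) => u1.
  have : 0 < `|l| by rewrite normr_gt0 gt_eqF.
  by rewrite normc_norm (ltcR 0) => nl0; rewrite ger_pMr// ltW.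
have [M MD] := bD n; pose l := (`|M| + 1) / e.
have l0 : 0 < l by rewrite divr_gt0// ltr_wpDl.
exists (l%:C); first by rewrite (ltcR 0).
move=> v Dv; exists ((l%:C)^-1 *: v); last first.
  by rewrite scalerA mulfV ?scale1r// gt_eqF// (ltcR 0).
apply: eU; rewrite subr0 (is_normZ (nrm_norm n)) normcV (normcR (ltW l0)).
rewrite mulrC ltr_pdivrMr// /l mulrC divfK ?gt_eqF//.
by have := MD _ Dv; have := ler_norm M; lra.
Qed.

Section WeightedSquares.
Variable (a : nat -> R).
Hypothesis a_ge0 : forall n, 0 <= a n.

Definition wsq n (v : V) : R := \sum_(k < n) a k * nrm k v ^+ 2.

Lemma wsq_ge0 n v : 0 <= wsq n v.
Proof. by apply: sumr_ge0 => k _; rewrite mulr_ge0// sqr_ge0. Qed.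

Lemma wsq_le m n v : (m <= n)%N -> wsq m v <= wsq n v.
Proof.
move=> /subnK <-; elim: (n - m)%N => // k IH; rewrite addSn /wsq big_ord_recr /=.
by rewrite (le_trans IH)// lerDl mulr_ge0// sqr_ge0.
Qed.

Lemma le_wsq k n v : (k < n)%N -> a k * nrm k v ^+ 2 <= wsq n v.
Proof.
move=> kn; apply: le_trans (wsq_le v kn); rewrite /wsq big_ord_recr /= lerDr.
exact: wsq_ge0.
Qed.

Lemma wsq_continuous n : continuous (wsq n).
Proof.
move=> x; elim: n => [|n IH].
  have -> : wsq 0 = cst 0 by apply/funext => v; rewrite /wsq big_ord0.
  exact: cvg_cst.
have -> : wsq n.+1 = (fun v => wsq n v + a n * nrm n v ^+ 2).
  by apply/funext => v; rewrite /wsq big_ord_recr.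
have c2 : (fun v => nrm n v ^+ 2) @ x --> nrm n x ^+ 2.
  by rewrite expr2; apply: cvgM; exact: nrm_continuous.
apply: cvgD => //; apply: cvgM c2; exact: cvg_cst.
Qed.

End WeightedSquares.
End CountablyNormedSpace.
Arguments wsq {R V} nrm a n v.

(** * Common points of families of closed midpoint-convex sets *)

Section CountablyHilbertSpace.
Context {R : realType} {V : topologicalLmodType R[i]} {nrm : nat -> V -> R}.
Hypothesis hH : countably_hilbert nrm.
Hypothesis nrm_mono : forall n (v : V), nrm n v <= nrm n.+1 v.

Let hV := countably_hilbert_normed hH.

Lemma nrm_forms : exists B : nat -> V -> V -> R[i],
  forall n, quadratic_form_of (B n) (fun v => nrm n v ^+ 2).
Proof.
have /choice[B BP] n := inner_product_quadratic_form (countably_hilbert_inner hH n).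
by exists B.
Qed.

Lemma wsq_form a : (forall n, 0 <= a n) -> forall n,
  exists B, quadratic_form_of B (wsq nrm a n).
Proof.
move=> a0 n; have [B hB] := nrm_forms.
by eexists; exact: (quadratic_form_sum n a0 hB).
Qed.

(* The almost minimizers of [wsq nrm a n] on the sets of [CC] form a Cauchy
   filter, by the parallelogram law. *)
Lemma closed_convex_common_point a (CC : set_system V) :
  (forall n, 0 < a n) -> CC !=set0 -> setI_closed CC ->
  (forall C, CC C -> closed C) ->
  (forall C u v, CC C -> C u -> C v -> C (2^-1 *: (u + v))) ->
  (forall C n, CC C -> exists2 v, C v & wsq nrm a n v <= 1) ->
  exists2 v, forall C, CC C -> C v & forall n, wsq nrm a n v <= 1.
Proof.
move=> a_gt0 [C0 CC0] CCI CCc CCm CC1.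
have a_ge0 n : 0 <= a n by exact: ltW.
have q0 := wsq_ge0 a_ge0.
pose d C n := inf [set wsq nrm a n v | v in C].
have has_infd C n : CC C -> has_inf [set wsq nrm a n v | v in C].
  move=> CC_C; have [v Cv _] := CC1 C n CC_C.
  by split; [exists (wsq nrm a n v), v | exists 0 => _ [w _ <-]].
have d_le C n v : CC C -> C v -> d C n <= wsq nrm a n v.
  by move=> CC_C Cv; apply: ge_inf; [case: (has_infd C n CC_C) | exists v].
have d1 C n : CC C -> d C n <= 1.
  by move=> CC_C; have [v Cv] := CC1 C n CC_C; apply: le_trans; exact: d_le.
pose S := [set d p.1 p.2 | p in [set p : set V * nat | CC p.1]].
have supS : has_sup S.
  split; first by exists (d C0 0), (C0, 0%N).
  by exists 1 => _ [[C n] /= CC_C <-]; exact: d1.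
(* One level [s <= 1] serves for all sets and all indices at once: each infimum [d C n] is at most
   [s], so the sets [B] below are nonempty. *)
pose s := sup S.
have d_s C n : CC C -> d C n <= s.
  by move=> CC_C; apply: ub_le_sup; [case: supS | exists (C, n)].
have s1 : s <= 1.
  by apply: ge_sup; [case: supS | move=> _ [[C n] /= CC_C <-]; exact: d1].
pose D := [set p : set V * nat * R | CC p.1.1 /\ 0 < p.2].
pose B (p : set V * nat * R) := p.1.1 `&` [set v | wsq nrm a p.1.2 v <= s + p.2].
have FB : ProperFilter (filter_from D B).
  apply: filter_from_proper; last first.
    move=> [[C n] e] /= [CC_C e0].
    have [_ [v Cv <-] dv] := inf_adherent e0 (has_infd C n CC_C).
    exists v; split => //=; apply: ltW; apply: lt_le_trans dv _.
    by rewrite lerD2r; exact: d_s.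
  apply: filter_from_filter; first by exists (C0, 0%N, 1).
  move=> [[C m] e] [[C' n] e'] /= [CC_C e0] [CC_C' e'0].
  exists (C `&` C', maxn m n, Num.min e e').
    by split=> /=; [exact: CCI | rewrite lt_min e0].
  move=> v [/= [Cv C'v] vs]; split; split=> //=.
    apply: (le_trans (wsq_le a_ge0 v (leq_maxl m n))).
    by apply: le_trans vs _; rewrite lerD2l ge_min lexx.
  apply: (le_trans (wsq_le a_ge0 v (leq_maxr m n))).
  by apply: le_trans vs _; rewrite lerD2l ge_min lexx orbT.
have [l Fl] : exists l : V, filter_from D B --> l.
  apply: (countably_hilbert_complete hH) => U.
  move=> /(nbhs_nrmP hV nrm_mono)[n [e [e0 eU]]].
  (* The parallelogram law will give [wsq nrm a k (u - v) <= 4 * (s + h) - 4 * d C m < 8 * h], which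
     is below [9 * h = a n * e ^+ 2]. *)
  pose h := a n * e ^+ 2 / 9.
  have h0 : 0 < h by rewrite divr_gt0// mulr_gt0// exprn_gt0.
  have [_ [[C m] /= CC_C <-] sC] := sup_adherent h0 supS.
  (* [k >= m] keeps the midpoint value at least [d C m]; [k > n] makes the [n]-th square a term of
     [wsq nrm a k]. *)
  pose k := maxn m n.+1.
  exists (B (C, k, h), B (C, k, h)).
    by split; exists (C, k, h).
  move=> [u v] [/= [Cu us] [Cv vs]]; apply: eU; rewrite subr0 /=.
  have [Bk hBk] := wsq_form a_ge0 k.
  have par := quadratic_form_parallelogram u v hBk.
  have := d_le C m _ CC_C (CCm _ _ _ CC_C Cu Cv).
  move=> /le_trans /(_ (wsq_le a_ge0 _ (leq_maxl m n.+1))).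
  rewrite -/k (quadratic_formZ _ _ hBk).
  have -> : normc (2^-1 : R[i]) ^+ 2 = 4^-1.
    have -> : (2^-1 : R[i]) = (2^-1)%:C by rewrite fmorphV rmorph_nat.
    by rewrite normcR ?invr_ge0//; field.
  move=> mid; have nuv : a n * nrm n (u - v) ^+ 2 <= wsq nrm a k (u - v).
    by apply: le_wsq => //; exact: leq_maxr.
  have nuv_lt : a n * nrm n (u - v) ^+ 2 < a n * e ^+ 2.
    apply: le_lt_trans nuv _.
    have -> : a n * e ^+ 2 = 9 * h by rewrite /h; field.
    move: sC us vs mid par h0; rewrite -/s /=. lra.
  move: nuv_lt; rewrite ltr_pM2l// ltr_pXn2r ?nnegrE ?(ltW e0)//.
  exact: (is_norm_ge0 (countably_normed_norm hV n)).
exists l => [C CC_C|n].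
  have FC : filter_from D B C by exists (C, 0%N, 1) => //= v [].
  exact: (closed_cvg (u_ := id) _ (CCc _ CC_C) FC l Fl).
apply: le_trans s1; apply/ler_addgt0Pr => e e0.
have Fn : filter_from D B [set v | wsq nrm a n v <= s + e].
  by exists (C0, n, e) => //= v [].
apply: (closed_cvg (u_ := wsq nrm a n) _ (@closed_le _ (s + e)) Fn).
apply: (cvg_trans (cvg_app (wsq nrm a n) Fl)); exact: wsq_continuous.
Qed.

End CountablyHilbertSpace.

(** * Ellipsoids: functionals on them, weak compactness, and absorption of bounded sets *)

Section Ellipsoids.
Context {R : realType} {V : topologicalLmodType R[i]} {nrm : nat -> V -> R}.
Hypothesis hH : countably_hilbert nrm.
Hypothesis nrm_mono : forall n (v : V), nrm n v <= nrm n.+1 v.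

Let hV := countably_hilbert_normed hH.

Lemma Re_continuous : continuous (@complex.Re R : R[i]^o -> R).
Proof.
move=> x; apply/(@cvgrPdist_lt R R^o _ _ (nbhs_filter (x : R[i]^o))) => e e0.
have e0' : 0 < e%:C by rewrite (ltcR 0).
near=> y; have : ball (x : R[i]^o) e%:C y by near: y; exact: nbhsx_ballx.
rewrite -ball_normE /= normc_norm ltcR; apply: le_lt_trans.
by rewrite -raddfB Re_le_normc.
Unshelve. all: by end_near. Qed.

Lemma dual_midpoint (g : dual V) u v :
  g (2^-1 *: (u + v)) = 2^-1 * ((g u : R[i]) + g v).
Proof. by rewrite linearZ linearD. Qed.

Section Ellipsoid.
Variable a : nat -> R.
Hypothesis a_gt0 : forall n, 0 < a n.

Let a_ge0 n : 0 <= a n. Proof. exact: ltW. Qed.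

Definition ellipsoid : set V := [set v | forall n, wsq nrm a n v <= 1].

Lemma wsqZ n (c : R[i]) v : wsq nrm a n (c *: v) = normc c ^+ 2 * wsq nrm a n v.
Proof. by have [B /quadratic_formZ] := wsq_form hH a_ge0 n. Qed.

(** Otherwise, for each [n], dividing a violating [v] by [g v] gives a point of the hyperplane
    [g = 1] with [wsq nrm a n] at most 1. The family consisting of this hyperplane alone then has a
    point in the ellipsoid, a contradiction. *)
Lemma dual_le_wsq (g : dual V) : (forall v, ellipsoid v -> normc (g v) < 1) ->
  exists n, forall v, normc (g v) ^+ 2 <= wsq nrm a n v.
Proof.
move=> g1; apply: contrapT => gn.
have gv1 n : exists2 v, g v = 1 & wsq nrm a n v <= 1.
  apply: contrapT => nv; apply: gn; exists n => v.
  have [->|gv0] := eqVneq (g v) 0.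
    by rewrite normc0 expr0n /= wsq_ge0.
  have ngv : 0 < normc (g v).
    rewrite lt_neqAle normc_ge0 andbT eq_sym; apply: contra gv0.
    by move=> /eqP/eq0_normc ->.
  rewrite leNgt; apply/negP => vg; apply: nv; exists ((g v)^-1 *: v).
    by rewrite linearZ; exact: mulVf.
  by rewrite wsqZ normcV exprVn mulrC ler_pdivrMr ?mul1r ?ltW// exprn_gt0.
have [|||||v gv v1] := @closed_convex_common_point _ _ _ hH nrm_mono a
  [set [set v | g v = 1]] a_gt0.
- by exists [set v | g v = 1].
- by move=> A B -> ->; rewrite setIid.
- move=> _ ->; apply: (@closed_comp _ _ (g : V -> R[i]^o) [set 1]).
    by move=> v _; exact: dual_continuous.
  apply: accessible_closed_set1; apply: hausdorff_accessible.
  exact: (@norm_hausdorff _ R[i]^o).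
- move=> _ u v -> /= gu gv; rewrite dual_midpoint gu gv.
  by apply: mulVf; rewrite pnatr_eq0.
- by move=> _ n -> /=.
have := g1 v v1; rewrite (gv _ erefl).
have -> : normc (1 : R[i]) = 1 by exact: normc1.
by rewrite ltxx.
Qed.

Lemma i01_real (l : {i01 R[i]}) :
  exists2 t : R, 0 <= t <= 1 & l%:num = t%:C.
Proof.
have l0 : 0 <= l%:num by []. have l1 : l%:num <= 1 by [].
have lE : l%:num = (complex.Re l%:num)%:C by rewrite RRe_real// ger0_real.
by exists (complex.Re l%:num); rewrite // -(lecR 0) -lecR -lE l0.
Qed.

(** For compactness, an ultrafilter containing the ellipsoid is shown to converge weakly to a common
    point of its closed midpoint-convex members. *)
Lemma ellipsoid_mackey : mackey_family ellipsoid.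
Proof.
split.
- move=> c v; rewrite normc_norm -[1]/(1%:C) lecR => c1 Kv n; rewrite wsqZ.
  have q0 : 0 <= wsq nrm a n v by exact: wsq_ge0.
  rewrite -[leRHS](mulr1 1) ler_pM ?sqr_ge0 ?Kv// expr_le1 ?normc_ge0//.
- move=> u v l /set_mem Ku /set_mem Kv; apply/mem_set => n.
  have [t t01 lt] := i01_real l.
  have [B /quadratic_form_convex/(_ t01)] := wsq_form hH a_ge0 n.
  move=> /(_ u v); rewrite /conv /= lt => /le_trans; apply.
  have := Ku n; have := Kv n; move: t01 => /andP[]; nra.
- rewrite /weakly_compact compact_ultra => F UF FK.
  have FF : ProperFilter F := @ultra_proper _ _ UF.
  pose CC := [set C : set V | [/\ F C, closed C &
    forall u v, C u -> C v -> C (2^-1 *: (u + v))]].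
  have [|||||v CCv v1] := @closed_convex_common_point _ _ _ hH nrm_mono a CC a_gt0.
  + exists setT; split=> //; first exact: filterT.
  + move=> A B [FA cA mA] [FB cB mB]; split; [exact: filterI|exact: closedI|].
    by move=> u v [Au Bu] [Av Bv]; split; [exact: mA|exact: mB].
  + by move=> C [].
  + by move=> C u v [_ _]; apply.
  + move=> C n [FC _ _].
    by have [v [Cv Kv]] := filter_ex (filterI FC FK); exists v.
  exists v; split=> //; apply: weak_cvg => f.
  (* If this open half-space were not in [F], its complement would be, and being closed and
     midpoint-convex it would contain [v]. *)
  have half (g : dual V) (r : R) : 0 < r ->
      F [set x | complex.Re (g x) < complex.Re (g v) + r].
    move=> r0.
    have [//|FC] := in_ultra_setVsetC
      [set x | complex.Re (g x) < complex.Re (g v) + r] UF.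
    suff : complex.Re (g v) + r <= complex.Re (g v) by move: r0; lra.
    apply: (CCv [set x | complex.Re (g v) + r <= complex.Re (g x)]); split.
    - by apply: filterS FC => x /= /negP; rewrite -leNgt.
    - apply: (@closed_comp _ _ (fun x : V => complex.Re (g x)) 
        [set y | complex.Re (g v) + r <= y]); last exact: closed_ge.
      move=> x _; apply: (@continuous_comp _ _ _ (g : V -> R[i]^o)).
        exact: dual_continuous.
      exact: Re_continuous.
    - move=> x y /= gx gy; rewrite dual_midpoint.
      have -> : complex.Re (2^-1 * (g x + g y)) = 
          2^-1 * (complex.Re (g x) + complex.Re (g y)).
        have -> : (2^-1 : R[i]) = (2^-1)%:C by rewrite fmorphV rmorph_nat.
        by case: (g x) (g y) => ? ? [? ?] /=; rewrite mul0r subr0.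
      lra.
  apply/cvgrPdist_lt => e e0.
  have eE : e = (complex.Re e)%:C by rewrite RRe_real// gtr0_real.
  rewrite eE (ltcR 0) in e0; rewrite eE.
  move: (complex.Re e) e0 => r r0; have r20 : 0 < r / 2 by rewrite divr_gt0.
  (* The multiples of [f] by 1, -1, ['i] and [- 'i] bound its real and imaginary parts from both
     sides. *)
  have H1 := half f _ r20; have H2 := half (- f) _ r20.
  have H3 := half ('i *: f) _ r20; have H4 := half ((- 'i) *: f) _ r20.
  have fE c x : (c *: f) x = c * f x by [].
  have fN x : (- f) x = - f x by [].
  apply: filterS (filterI (filterI H1 H2) (filterI H3 H4)) => x [[h1 h2] [h3 h4]].
  move: h1 h2 h3 h4; rewrite /mkset !fE !fN normc_norm ltcR => h1 h2 h3 h4.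
  apply: le_lt_trans (normc_le_ReIm _) _; move: h1 h2 h3 h4.
  case: (f x) (f v) => x1 x2 [y1 y2] /=.
  move=> h1 h2 h3 h4; have : `|y1 - x1| < r / 2 by rewrite ltr_norml; lra.
  have : `|y2 - x2| < r / 2 by rewrite ltr_norml; lra.
  lra.
Qed.

Lemma ellipsoid_bounded : bounded_in ellipsoid.
Proof.
apply/(bounded_inP hV nrm_mono) => n; exists (1 + (a n)^-1) => v Kv.
have : a n * nrm n v ^+ 2 <= 1 by apply: le_trans (Kv n.+1); exact: le_wsq.
rewrite mulrC -ler_pdivlMr// mul1r.
have := sqr_ge0 (nrm n v - 1).
have := is_norm_ge0 (countably_normed_norm hV n) v; nra.
Qed.


End Ellipsoid.

Lemma bounded_sub_ellipsoid (D : set V) : bounded_in D ->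
  exists2 a : nat -> R, (forall n, 0 < a n) & D `<=` ellipsoid a.
Proof.
move=> /(bounded_inP hV nrm_mono)/choice[M DM].
have d0 n : 0 < 1 + M n ^+ 2 by rewrite ltr_pwDl// sqr_ge0.
(* On [D] the [n]-th term is then at most [2^-1 ^+ n.+1], so partial sums stay below those of the
   geometric series. *)
pose a n := 2^-1 ^+ n.+1 / (1 + M n ^+ 2).
exists a => [n|v Dv n]; first by rewrite divr_gt0// exprn_gt0// invr_gt0.
suff : wsq nrm a n v <= 1 - 2^-1 ^+ n.
  have : 0 <= (2^-1 : R) ^+ n by apply: exprn_ge0; rewrite invr_ge0.
  lra.
elim: n => [|n IH]; first by rewrite /wsq big_ord0 expr0 subrr.
rewrite /wsq big_ord_recr /=; move: IH; rewrite -/(wsq nrm a n v).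
suff : a n * nrm n v ^+ 2 <= 2^-1 ^+ n.+1 by rewrite (exprS 2^-1); rewrite /wsq; lra.
rewrite /a mulrAC ler_pdivrMr// ler_wpM2l ?exprn_ge0 ?invr_ge0//.
have := DM n v Dv; have := is_norm_ge0 (countably_normed_norm hV n) v; nra.
Qed.
End Ellipsoids.

(** * Extension of bounded functionals to a completion *)

Section Extension.
Context {R : realType} {E : lmodType R[i]} {N : E -> R}.
Context {W : completeNormedModType R[i]} {iota : {linear E -> W}}.
Hypothesis hW : is_completion N iota.

Let nW (w : W) : R := complex.Re `|w|.

Let nWE w : `|w| = (nW w)%:C.
Proof. by rewrite /nW RRe_real// normr_real. Qed.

Let nW_iota v : nW (iota v) = N v.
Proof. by have [H _] := hW; rewrite /nW H. Qed.

Let nW_ge0 w : 0 <= nW w.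
Proof. by rewrite -(lecR 0) -nWE normr_ge0. Qed.

Let nWD u v : nW (u + v) <= nW u + nW v.
Proof. by rewrite -lecR -nWE (le_trans (ler_normD _ _))// !nWE -rmorphD. Qed.

Let nWZ a v : nW (a *: v) = normc a * nW v.
Proof. by apply: (@complexI R); rewrite -nWE normrZ nWE -rmorphM. Qed.

Let nW_dense w (e : R) : 0 < e -> exists v, nW (w - iota v) < e.
Proof.
move=> e0; have eC : 0 < e%:C by rewrite (ltcR 0).
have [_ dW] := hW.
have [|y [+ [v _ vy]]] := dW (interior (ball w e%:C)) _ (@open_interior _ _).
  by exists w; exact: (nbhsx_ballx w _ eC).
move=> /interior_subset; rewrite -vy => we; exists v.
by move: we; rewrite -ball_normE /= nWE ltcR.
Qed.

(** The value at [w] is a number within [c * nW (w - iota v)] of [h v] for every [v] simultaneously,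
    found from the filter of values of [h] near [w]. Linearity, the extension property and the norm
    bound all follow from this one estimate. *)
Lemma completion_extension (c : R) (h : E -> R[i]^o) : linear h -> 0 <= c ->
  (forall v, normc (h v) <= c * N v) ->
  exists2 H : dual W, forall v, H (iota v) = h v & opnorm H <= c.
Proof.
move=> lh c0 hc.
have hB u v : normc (h u - h v) <= c * nW (iota u - iota v).
  rewrite -linearB nW_iota; have -> : h u - h v = h (u - v); last exact: hc.
  by rewrite [u - v]addrC -[- v]scaleN1r lh scaleN1r addrC.
have /choice[H HP] w : exists z, forall v, normc (z - h v) <= c * nW (w - iota v).
  pose B (e : R) := [set v | nW (w - iota v) < e].
  pose F := filter_from [set e : R | 0 < e] (fun e => h @` B e).
  have FF : ProperFilter F.
    apply: filter_from_proper; last first.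
      by move=> e /(nW_dense w)[v vw]; exists (h v), v.
    apply: filter_from_filter; first by exists 1 => /=.
    move=> e e' /= e0 e'0; exists (Num.min e e') => /=; first by rewrite lt_min e0.
    by move=> _ [v + <-]; rewrite /B /= lt_min => /andP[? ?]; split; exists v.
  have Fball v e : 0 < e ->
      F [set y | normc (y - h v) <= c * (nW (w - iota v) + e)].
    move=> e0; exists e => //= _ [u /= uw <-].
    apply: le_trans (hB u v) _; apply: ler_wpM2l => //.
    have := nWD (iota u - w) (w - iota v); rewrite addrA subrK.
    have -> : nW (iota u - w) = nW (w - iota u) by rewrite /nW distrC.
    by move: uw; rewrite /B /=; lra.
  have [z zP] := filter_closed_ball FF (Fball 0 1 ltr01).
  exists z => v; apply/ler_addgt0Pr => e e0.
  have c10 : 0 < c + 1 by rewrite ltr_wpDl.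
  have e10 : 0 < e / (c + 1) by rewrite divr_gt0.
  apply: le_trans (zP _ _ (Fball v _ e10)) _.
  rewrite mulrDr lerD2l mulrCA ger_pMr// ler_pdivrMr// mul1r; lra.
have h0 : h 0 = 0.
  by have := lh (-1) 0 0; rewrite scaler0 addr0 => ->; rewrite scaleN1r addNr.
have Hc w : normc (H w) <= c * nW w.
  by have := HP w 0; rewrite h0 (linear0 iota) !subr0.
have lH : linear (H : W -> R[i]^o).
  move=> b w w'; apply/eqP; rewrite -subr_eq0; apply/eqP/eq0_normc/eqP.
  rewrite eq_le normc_ge0 andbT; apply/ler_addgt0Pr => e e0; rewrite add0r.
  (* Approximating [w] and [w'] within [d] costs at most [2 * c * (normc b + 1) * d] in total; the
     summand 1 makes [K] positive. *)
  pose K := 2 * c * (normc b + 1) + 1.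
  have K0 : 0 < K by have := normc_ge0 b; rewrite /K; nra.
  have [d d0 dE] : exists2 d, 0 < d & K * d = e.
    by exists (e / K); [rewrite divr_gt0 | rewrite mulrC divfK// gt_eqF].
  have [v vw] := nW_dense w d0; have [v' vw'] := nW_dense w' d0.
  have H1 := HP (b *: w + w') (b *: v + v').
  have H2 := HP w v; have H3 := HP w' v'.
  have D1 : nW (b *: w + w' - iota (b *: v + v')) <=
      normc b * nW (w - iota v) + nW (w' - iota v').
    by rewrite linearP opprD addrACA -scalerBr -nWZ; exact: nWD.
  have -> : H (b *: w + w') - (b *: (H w : R[i]^o) + H w') =
      (H (b *: w + w') - h (b *: v + v')) +
      (b * (h v - H w) + (h v' - H w')).
    rewrite lh -[b *: H w]/(b * H w) -[b *: h v]/(b * h v).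
    by move: (H _) (H _) (h _) (H w') (h v') => *; ring.
  apply: le_trans (normc_ler_norm _ _) _.
  have := normc_ler_norm (b * (h v - H w)) (h v' - H w').
  rewrite normcM (normc_sub _ (H w)) (normc_sub _ (H w')).
  have b0 := normc_ge0 b; have nw := nW_ge0 (w - iota v).
  have nw' := nW_ge0 (w' - iota v').
  have H1' := le_trans H1 (ler_wpM2l c0 D1).
  have H2' : normc b * normc (H w - h v) <= normc b * (c * d).
    by apply: ler_wpM2l => //; apply: le_trans H2 _; apply: ler_wpM2l => //; exact: ltW.
  have H3' : normc (H w' - h v') <= c * d.
    by apply: le_trans H3 _; apply: ler_wpM2l => //; exact: ltW.
  have H4 : c * (normc b * nW (w - iota v) + nW (w' - iota v')) <=
      c * ((normc b + 1) * d).
    apply: ler_wpM2l => //; rewrite mulrDl mul1r lerD ?(ltW vw')//.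
    by apply: ler_wpM2l => //; exact: ltW.
  move: H1' H2' H3' H4 d0; rewrite -dE /K; lra.
have HW : (H : W -> R[i]^o) \in @dual_pred _ W.
  apply: (linear_bound_dual (p := nW)) c0 lH Hc => x e e0.
  have eC : 0 < e%:C by rewrite (ltcR 0).
  near=> y; have : ball x e%:C y by near: y; exact: nbhsx_ballx.
  by rewrite -ball_normE /= distrC nWE ltcR.
exists (Dual HW) => [v|].
  apply/eqP; rewrite -subr_eq0; apply/eqP/eq0_normc/eqP.
  rewrite eq_le normc_ge0 andbT; apply: le_trans (HP (iota v) v) _.
  by rewrite subrr /nW normr0 mulr0.
apply: opnorm_le => w w1; apply: le_trans (Hc w) _.
by rewrite ler_piMr// -(lecR _ 1) -nWE.
Unshelve. all: by end_near. Qed.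

End Extension.

(** * Weakly bounded sets are bounded in every norm *)

Section UniformBoundedness.
Context {R : realType} {V : topologicalLmodType R[i]} {nrm : nat -> V -> R}.
Hypothesis hH : countably_hilbert nrm.

Let hV := countably_hilbert_normed hH.

Lemma le0_of_geometric (r K : R) :
  (forall n, r <= K * 3^-1 ^+ n) -> r <= 0.
Proof.
move=> rK; apply/ler_addgt0Pr => e e0; rewrite add0r.
pose n := Num.truncn (`|K| / e).
have Kn : `|K| / e < n.+1%:R by exact: truncnS_gt.
have n3 : n.+1%:R <= 3 ^+ n.+1 :> R.
  by rewrite -natrX ler_nat ltnW// ltn_expl.
apply: le_trans (rK n.+1) _; rewrite exprVn ler_pdivrMr ?exprn_gt0//.
apply: le_trans (ler_norm K) _; rewrite mulrC -ler_pdivrMr//.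
by apply: le_trans n3; exact: ltW.
Qed.

(* Sokal's gliding hump: an unbounded functional is the limit [g] of the partial
   sums [f n] of [s_n 3^-n B(., w_n) / |w_n|_k], with signs [s_n] chosen so that
   [f n.+1] is large at [w_n]. *)
Lemma weakly_bounded_nrm (D : set V) k :
  (forall f : dual V, exists M : R, forall v, D v -> normc (f v) <= M) ->
  exists M : R, forall v, D v -> nrm k v <= M.
Proof.
move=> Dw; apply: contrapT => unb.
have N0 v : 0 <= nrm k v := is_norm_ge0 (countably_normed_norm hV k) v.
pose t n : R := 3^-1 ^+ n.
have t0 n : 0 < t n by rewrite exprn_gt0// invr_gt0.
have tS n : t n.+1 = t n / 3 by rewrite /t exprSr.
(* The factor 2 allows for the tail after step [n], which can cancel up to half of
   [t n * nrm k (w n)]. *)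
have /choice[w wP] n : exists v, D v /\ 2 * n.+1%:R < t n * nrm k v.
  apply: contrapT => nv; apply: unb; exists (2 * n.+1%:R / t n) => v Dv.
  rewrite leNgt; apply/negP => vn; apply: nv; exists v; split => //.
  by rewrite [t n * _]mulrC -ltr_pdivrMr.
have [B hB] := nrm_forms hH; have [lB _ BE _] := hB k.
have Nw n : 0 < nrm k (w n).
  rewrite -(pmulr_rgt0 _ (t0 n)); apply: lt_trans (wP n).2.
  by rewrite mulr_gt0.
pose b n y := (t n / nrm k (w n))%:C * B k y (w n).
have b_le n y : normc (b n y) <= t n * nrm k y.
  rewrite /b normcM normcR; last by rewrite divr_ge0 ?ltW.
  rewrite mulrAC ler_pdivrMr// -mulrA ler_pM2l//.
  rewrite -(@ler_pXn2r _ 2) ?nnegrE ?mulr_ge0 ?normc_ge0//.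
  by rewrite exprMn mulrC; exact: quadratic_form_CauchySchwarz (hB k).
have bw n : normc (b n (w n)) = t n * nrm k (w n).
  rewrite /b BE -rmorphM normcR.
    by rewrite expr2 mulrA divfK ?gt_eqF//.
  by rewrite mulr_ge0 ?sqr_ge0// divr_ge0 ?ltW.
have lb n : linear (b n : V -> R[i]^o).
  by move=> c x y; rewrite /b lB mulrDr; congr (_ + _); exact: mulrCA.
(* One of [x + y] and [x - y] has modulus at least that of [y], because they differ by [2 * y]. *)
have /choice[sg sgP] (p : nat * (V -> R[i])) : exists s : R[i], normc s = 1 /\
    t p.1 * nrm k (w p.1) <= normc (p.2 (w p.1) + s * b p.1 (w p.1)).
  case: p => n g /=; have n1 : normc (1 : R[i]) = 1 by exact: normc1.
  set x := g _; set y := b _ _; rewrite -bw -/y.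
  have [yx|xy] := leP (normc y) (normc (x + y)).
    by exists 1; rewrite mul1r.
  exists (-1); rewrite mulN1r normc_opp n1; split=> //.
  have := normc_ler_norm (x + y) (- (x - y)).
  have -> : x + y - (x - y) = 2%:C * y by rewrite rmorph_nat; ring.
  by rewrite normcM normcR// normc_opp; move: xy; lra.
pose f n := iteri n (fun m g y => g y + sg (m, g) * b m y) (fun=> 0).
have fS n y : f n.+1 y = f n y + sg (n, f n) * b n y by [].
have lf n : linear (f n : V -> R[i]^o).
  elim: n => [|n IH] c x y; first by rewrite /f /= scaler0 addr0.
  rewrite fS IH lb !fS -![_ *: _]/(_ * _); move: (f n x) (f n y) (b n x) (b n y).
  by move=> *; ring.
(* The geometric sum of [t m] over [n <= m < n + j] is [3 / 2 * (t n - t (n + j))]. *)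
have f_dist n j y : normc (f (n + j)%N y - f n y) <=
    3 / 2 * (t n - t (n + j)%N) * nrm k y.
  elim: j => [|j IH]; first by rewrite addn0 !subrr normc0 mulr0 mul0r.
  rewrite addnS fS addrAC; apply: le_trans (normc_ler_norm _ _) _.
  rewrite normcM (sgP (_, _)).1 mul1r tS.
  by have := b_le (n + j)%N y; move: IH; lra.
have /choice[g gP] y : exists z : R[i], forall n,
    normc (z - f n y) <= 3 / 2 * t n * nrm k y.
  have Fn n : (f^~ y @ \oo) [set z | normc (z - f n y) <= 3 / 2 * t n * nrm k y].
    exists n => // m /= /subnKC <-; apply: le_trans (f_dist _ _ _) _.
    apply: ler_wpM2r => //; rewrite ler_pM2l ?divr_gt0// gerBl.
    exact: ltW.
  have [z zP] := filter_closed_ball (_ : ProperFilter (f^~ y @ \oo)) (Fn 0%N).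
  by exists z => n; exact: zP.
have f0 y : f 0%N y = 0 by [].
have lg : linear (g : V -> R[i]^o).
  move=> c x y; apply/eqP; rewrite -subr_eq0; apply/eqP/eq0_normc/eqP.
  rewrite eq_le normc_ge0 andbT.
  apply: (@le0_of_geometric _ (3 / 2 * (nrm k (c *: x + y) + normc c * nrm k x
    + nrm k y))) => n; rewrite -/(t n).
  have -> : g (c *: x + y) - (c *: (g x : R[i]^o) + g y) =
      (g (c *: x + y) - f n (c *: x + y)) +
      (- c * (g x - f n x) + - (g y - f n y)).
    have cM (z : R[i]) : c *: (z : R[i]^o) = c * z by [].
    rewrite lf !cM.
    by move: (g _) (g x) (g y) (f n x) (f n y) => *; ring.
  apply: le_trans (normc_ler_norm _ _) _.
  have := normc_ler_norm (- c * (g x - f n x)) (- (g y - f n y)).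
  rewrite normcM !normc_opp.
  have := gP (c *: x + y) n; have := gP y n.
  have : normc c * normc (g x - f n x) <= normc c * (3 / 2 * t n * nrm k x).
    by apply: ler_wpM2l (gP x n); exact: normc_ge0.
  lra.
have gD : (g : V -> R[i]^o) \in @dual_pred _ V.
  apply: (nrm_bounded_dual hV (n := k) (c := 3 / 2)) lg _.
    by rewrite divr_ge0.
  by move=> v; have := gP v 0%N; rewrite f0 subr0 /t expr0 mulr1.
have [M MD] := Dw (Dual gD).
pose n := Num.truncn M.
have := MD (w n) (wP n).1; have := truncnS_gt M; rewrite -/n /= => nM gM.
(* The value of [f n.+1] at [w n] is at least [t n * nrm k (w n)] and the tail at most half of that,
   so [g (w n)] exceeds [n.+1 > M] in modulus. *)
have := gP (w n) n.+1; have := (sgP (n, f n)).2; rewrite /= -fS tS normc_sub.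
have := normc_ler_norm (f n.+1 (w n) - g (w n)) (g (w n)); rewrite subrK.
have := (wP n).2; lra.
Qed.

End UniformBoundedness.

(** The weights 1/2, 1/4, ..., with the last one repeated on [r], sum to 1. One midpoint splits off
    [h 0], and induction applies to the shifted sequence. *)
Lemma midpoint_comb {R : realType} {E : lmodType R[i]} (A : set E) n
    (h : nat -> E) (r : E) :
  (forall x y, A x -> A y -> A (2^-1 *: (x + y))) ->
  (forall k, (k < n)%N -> A (h k)) -> A r ->
  A (\sum_(k < n) (2^-1) ^+ k.+1 *: h k + (2^-1) ^+ n *: r).
Proof.
move=> Am; elim: n h => [|n IH] h Ah Ar.
  by rewrite big_ord0 add0r expr0 scale1r.
have := Am _ _ (Ah 0%N isT) (IH (h \o S) (fun k kn => Ah k.+1 kn) Ar).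
congr A; rewrite big_ord_recl expr1 !scalerDr scaler_sumr scalerA -exprS addrA.
by congr (_ + _ + _); apply: eq_bigr => k _; rewrite scalerA -exprS.
Qed.

Lemma normc_continuous {R : realType} : continuous (@normc R : R[i]^o -> R).
Proof.
move=> x; apply/(@cvgrPdist_lt R R^o _ _ (nbhs_filter (x : R[i]^o))) => e e0.
have e0' : 0 < e%:C by rewrite (ltcR 0).
near=> y; have : ball (x : R[i]^o) e%:C y by near: y; exact: nbhsx_ballx.
rewrite -ball_normE /= normc_norm ltcR; apply: le_lt_trans.
have := normc_ler_norm (x - y) y; have := normc_ler_norm (y - x) x.
by rewrite !subrK (normc_sub y) ler_norml; lra.
Unshelve. all: by end_near. Qed.

(** * Polar topologies on the dual and local convexity of the strong one *)

Section DualTopologies.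
Context {R : realType} {V : topologicalLmodType R[i]}.

Lemma dual_sumE n (h : 'I_n -> dual V) v :
  (\sum_(k < n) h k) v = \sum_(k < n) h k v.
Proof. by elim/big_rec2: _ => // k y1 y2 _ <-. Qed.

Lemma polar_open_sub (S S' : set_system V) :
  (forall D, S D -> exists2 D', S' D' & D `<=` D') ->
  polar_open S `<=` polar_open S'.
Proof.
move=> SS' U oU f /oU[D [e [/SS'[D' SD' DD'] e0 DU]]]; exists D', e; split=> //.
by move=> g /(polar_le DD' (lexx e)); exact: DU.
Qed.

Lemma strong_openE : @open (strong_dual V) = polar_open [set D : set V | bounded_in D].
Proof. by []. Qed.

Lemma mackey_openE : @open (mackey_dual V) = polar_open (@mackey_family R V).
Proof. by []. Qed.

Lemma weakly_compact_dual_bounded (C : set V) (f : dual V) :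
  weakly_compact C -> exists M : R, forall v, C v -> normc (f v) <= M.
Proof.
move=> kC.
have : compact ((fun v : weak_topology => normc (f v)) @` C).
  apply: continuous_compact kC; apply: continuous_subspaceT => v.
  apply: (@continuous_comp _ _ _ (f : weak_topology -> R[i]^o)).
    exact: weak_continuous.
  exact: normc_continuous.
move=> /compact_bounded/pinfty_ex_gt0[M M0 MC]; exists M => v Cv.
by apply: le_trans (ler_norm _) _; apply: MC; exists v.
Qed.

Lemma polar_translate_open (D : set V) (e : R) (f : dual V) : bounded_in D ->
  @open (strong_dual V) [set g | polar D e (g - f)].
Proof.
rewrite strong_openE => bD g /=.
move=> /(polar_open_polar (S := [set D | bounded_in D]) bD)[D' [e' [? ? H]]].
by exists D', e'; split=> // h /H; rewrite /= addrAC.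
Qed.

Lemma strong_nbhsP (f : dual V) (U : set (dual V)) :
  nbhs (f : strong_dual V) U <-> exists D e,
    [/\ bounded_in D, 0 < e & forall g, polar D e g -> U (f + g)].
Proof.
rewrite nbhsE; split=> [[A [oA Af] AU]|[D [e [bD e0 DU]]]].
  move: oA; rewrite strong_openE => /(_ f Af)[D [e [bD e0 DA]]].
  by exists D, e; split=> // g /DA; exact: AU.
exists [set g | polar D e (g - f)].
  by split; [exact: polar_translate_open | rewrite /= subrr; exact: polar0].
by move=> g /= /DU; rewrite addrC subrK.
Qed.

Lemma convex_polar (D : set V) (e : R) (f : dual V) :
  convex_set ([set g | polar D e (g - f)] : set (dual V)).
Proof.
move=> g h l /set_mem/polarP[r re gr] /set_mem/polarP[s se hs]; apply/mem_set.
have [t /andP[t0 t1] lt] := i01_real l.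
apply/polarP; exists (t * r + (1 - t) * s).
  have [->|tn0] := eqVneq t 0; first by rewrite mul0r add0r subr0 mul1r.
  have tp : 0 < t by rewrite lt_neqAle eq_sym tn0.
  have : t * r < t * e by rewrite ltr_pM2l.
  have : (1 - t) * s <= (1 - t) * e by rewrite ler_wpM2l ?(ltW se)// subr_ge0.
  lra.
have convE : conv l (g : convex_lmodType (dual V)) h = t%:C *: g + (1 - t%:C) *: h.
  by rewrite /conv /= lt.
move=> v Dv; rewrite convE.
have -> : (t%:C *: g + (1 - t%:C) *: h - f) v =
    t%:C * (g - f) v + (1 - t)%:C * (h - f) v.
  have -> : (1 - t)%:C = 1 - t%:C by rewrite rmorphB.
  have -> : (t%:C *: g + (1 - t%:C) *: h - f) v =
    t%:C * g v + (1 - t%:C) * h v - f v by [].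
  have -> : (g - f) v = g v - f v by [].
  have -> : (h - f) v = h v - f v by [].
  by move: (g v) (h v) (f v) => x y z; ring.
apply: le_trans (normc_ler_norm _ _) _.
rewrite !normcM !normcR ?subr_ge0//.
by apply: lerD; apply: ler_wpM2l; rewrite ?subr_ge0 ?gr ?hs.
Qed.

Hypothesis bounded_dual : forall (D : set V) (f : dual V), bounded_in D ->
  exists M : R, forall v, D v -> normc (f v) <= M.

(** Scaling is continuous at [(z, f)] because [z' *: f' - z *: f] equals
    [z' *: (f' - f) + (z' - z) *: f], and [f] is bounded on [D]; each summand is given [e / 2]. *)
Lemma strong_lcv : lcv_topology (Topological.class (strong_dual V)).
Proof.
split.
- move=> [f g] U /= /strong_nbhsP[D [e [bD e0 DU]]].
  have e20 : 0 < e / 2 by rewrite divr_gt0.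
  exists ([set h | polar D (e / 2) (h - f)], [set h | polar D (e / 2) (h - g)]).
    split; apply/strong_nbhsP; exists D, (e / 2); split=> // h.
      by rewrite /= addrAC subrr add0r.
    by rewrite /= addrAC subrr add0r.
  move=> [f' g'] [/= /polarP[r re Dr] /polarP[s se Ds]].
  have -> : f' + g' = f + g + ((f' - f) + (g' - g)).
    by rewrite addrACA [f + _]addrC [g + _]addrC !subrK.
  apply: DU; apply/polarP; exists (r + s); first by move: re se; lra.
  move=> v Dv; apply: le_trans (normc_ler_norm _ _) _.
  by apply: lerD; [exact: Dr | exact: Ds].
- move=> [z f] U /= /strong_nbhsP[D [e [bD e0 DU]]].
  have [M MD] := bounded_dual f bD.
  pose k := normc z + 1; have k0 : 0 < k.
    by rewrite /k; have := normc_ge0 z; lra.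
  pose M' := `|M| + 1; have M'0 : 0 < M' by rewrite /M'; have := normr_ge0 M; lra.
  have ek0 : 0 < e / 2 / k by rewrite !divr_gt0.
  pose d := Num.min 1 (e / 2 / M').
  have d0 : 0 < d by rewrite lt_min ltr01 !divr_gt0.
  have dC : 0 < d%:C by rewrite (ltcR 0).
  exists (ball (z : R[i]^o) d%:C, [set h | polar D (e / 2 / k) (h - f)]).
    split; first exact: nbhsx_ballx.
    apply/strong_nbhsP; exists D, (e / 2 / k); split=> // h.
    by rewrite /= addrAC subrr add0r.
  move=> [z' f'] [/=]; rewrite -ball_normE /= normc_norm ltcR lt_min.
  move=> /andP[z1 zM] /polarP[r re Dr].
  have -> : z' *: f' = z *: f + (z' *: (f' - f) + (z' - z) *: f).
    by rewrite scalerBr scalerBl subrKA addrC subrK.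
  have zk : normc z' <= k.
    have := normc_ler_norm z (z' - z); rewrite addrC subrK (normc_sub z').
    by rewrite /k; move: z1; lra.
  apply: DU; apply/polarP; exists (k * Num.max r 0 + normc (z - z') * M').
    have : k * Num.max r 0 < e / 2.
      by rewrite mulrC -ltr_pdivlMr// gt_max re.
    have : normc (z - z') * M' < e / 2 by rewrite -ltr_pdivlMr.
    lra.
  move=> v Dv; have -> : (z' *: (f' - f) + (z' - z) *: f) v =
    z' * (f' - f) v + (z' - z) * f v by [].
  apply: le_trans (normc_ler_norm _ _) _; rewrite !normcM (normc_sub z').
  apply: lerD; apply: ler_pM; rewrite ?normc_ge0//.
    by rewrite le_max Dr.
  by apply: le_trans (MD v Dv) _; rewrite /M'; have := ler_norm M; lra.
- exists [set b | @open (strong_dual V) b /\ convex_set (b : set (dual V))].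
    by move=> b /set_mem[].
  split=> [b []//|f U /strong_nbhsP[D [e [bD e0 DU]]]].
  exists [set g | polar D e (g - f)]; last first.
    by move=> g /= /DU; rewrite addrC subrK.
  split; last by rewrite /= subrr; exact: polar0.
  by split; [exact: polar_translate_open | exact: convex_polar].
Qed.

End DualTopologies.

Lemma normc_le_opnorm {R : realType} {W : normedModType R[i]} (f : dual W) w :
  normc (f w) <= opnorm f * complex.Re `|w|.
Proof.
have wE : `|w| = (complex.Re `|w|)%:C by rewrite RRe_real// normr_real.
have w0 : 0 <= complex.Re `|w| by rewrite -(lecR 0) -wE normr_ge0.
have [->|wn0] := eqVneq w 0.
  by rewrite linear0 normc0 normr0 /= mulr0.
have wp : 0 < complex.Re `|w| by rewrite -(ltcR 0) -wE normr_gt0.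
rewrite -ler_pdivrMr// mulrC.
have -> : (complex.Re `|w|)^-1 * normc (f w) = normc (f (`|w|^-1 *: w)).
  have -> : f (`|w|^-1 *: w) = `|w|^-1 * f w by rewrite linearZ.
  by rewrite normcM normcV wE normcR.
by apply: opnorm_ub; rewrite normrZ normfV normr_id mulVf ?normr_eq0.
Qed.

(** * Comparison of the topologies on the dual of a countably-Hilbert space *)

Section DualOfCountablyHilbert.
Context {R : realType} {V : topologicalLmodType R[i]} {nrm : nat -> V -> R}.
Hypothesis hH : countably_hilbert nrm.
Hypothesis nrm_mono : forall n (v : V), nrm n v <= nrm n.+1 v.

Let hV := countably_hilbert_normed hH.

Lemma bounded_in_dual (D : set V) (f : dual V) : bounded_in D ->
  exists M : R, forall v, D v -> normc (f v) <= M.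
Proof.
move=> /(bounded_inP hV nrm_mono) bD.
have [n [c [c0 fc]]] := dual_nrm_bounded hV nrm_mono f.
have [M DM] := bD n; exists (c * M) => v Dv.
by apply: le_trans (fc v) _; apply: ler_wpM2l => //; exact: DM.
Qed.

Lemma weakly_compact_bounded (C : set V) : weakly_compact C -> bounded_in C.
Proof.
move=> kC; apply/(bounded_inP hV nrm_mono) => k.
by apply: (weakly_bounded_nrm hH) => f; exact: weakly_compact_dual_bounded.
Qed.

(* On the ellipsoid with weights [a k = (e k / 2 ^ (k + 2)) ^ 2] a functional
   bounded by 1 is, by the Riesz representation for [wsq nrm a n], a convex
   combination of functionals bounded by [e k * nrm k]. *)
Lemma polar_sub_midpoint_convex (A : set (dual V)) (e : nat -> R) :
  (forall f g, A f -> A g -> A (2^-1 *: (f + g))) -> (forall k, 0 < e k) ->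
  (forall k (f : dual V), (forall v, normc (f v) <= e k * nrm k v) -> A f) ->
  exists2 D : set V, bounded_in D & polar D 1 `<=` A.
Proof.
move=> Am e0 eA.
have N0 k v : 0 <= nrm k v := is_norm_ge0 (countably_normed_norm hV k) v.
(* As [c k * nrm k u <= 2] for the Riesz vector [u] and [k < n], the bound
   [2 ^+ k.+1 * a k * nrm k u] on [hf k] is at most [e k / 2 * 2]. *)
pose c k := e k / 2 ^+ k.+2.
have c0 k : 0 < c k by rewrite divr_gt0// exprn_gt0.
pose a k := c k ^+ 2.
have a0 k : 0 < a k by rewrite exprn_gt0.
have a_ge0 k : 0 <= a k by exact: ltW.
exists (ellipsoid (nrm := nrm) a); first exact: (ellipsoid_bounded hH nrm_mono a0).
move=> g /polarP[r0 r01 gr0].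
have [n gn] : exists n, forall v, normc (g v) ^+ 2 <= wsq nrm a n v.
  apply: (dual_le_wsq hH nrm_mono a0) => v Kv.
  by apply: le_lt_trans r01; exact: gr0.
have [B hB] := nrm_forms hH.
pose S : R := \sum_(k < n) a k.
have S0 : 0 <= S by apply: sumr_ge0.
(* With this [d] the Riesz error, scaled by [2 ^+ n], is bounded by [e n * nrm n], since
   [wsq nrm a n <= S * nrm n ^+ 2]. The sum [S] is 0 when [n = 0], hence [S + 1]. *)
pose d := e n ^+ 2 / (4 ^+ n * (S + 1)).
have S1 : 0 < S + 1 by rewrite ltr_wpDl.
have d0 : 0 < d by rewrite divr_gt0 ?exprn_gt0// mulr_gt0// exprn_gt0.
have [u u4 gu] := quadratic_form_Riesz (quadratic_form_sum n a_ge0 hB)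
  (@dual_linear _ _ g) gn d0.
rewrite -/(wsq nrm a n u) in u4.
(* The factor [2 ^+ k.+1] cancels the weight of the [k]-th term in the midpoint combination. *)
pose hf k v : R[i] := (2 ^+ k.+1 * a k)%:C * B k v u.
have lhf k : linear (hf k : V -> R[i]^o).
  have [lB _ _ _] := hB k.
  by move=> z x y; rewrite /hf lB mulrDr; congr (_ + _); exact: mulrCA.
have w0 k : 0 <= 2 ^+ k.+1 * a k by rewrite mulr_ge0// exprn_ge0.
have hf_le k v : normc (hf k v) <= 2 ^+ k.+1 * a k * nrm k u * nrm k v.
  rewrite /hf normcM normcR// -[leRHS]mulrA; apply: ler_wpM2l => //.
  rewrite -(@ler_pXn2r _ 2) ?nnegrE ?mulr_ge0 ?normc_ge0//.
  by rewrite exprMn; exact: quadratic_form_CauchySchwarz (hB k).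
have hfD k : (hf k : V -> R[i]^o) \in @dual_pred _ V.
  apply: (nrm_bounded_dual hV) (lhf k) (hf_le k).
  exact: mulr_ge0.
pose h k := Dual (hfD k).
(* The Riesz error takes the repeated last weight, as one more functional controlled by [nrm n]. *)
pose r : dual V := (2 ^+ n) *: (g - \sum_(k < n) (2^-1) ^+ k.+1 *: h k).
have -> : g = \sum_(k < n) (2^-1) ^+ k.+1 *: h k + (2^-1) ^+ n *: r.
  by rewrite /r scalerA -exprMn mulVf ?pnatr_eq0// expr1n scale1r addrC subrK.
apply: midpoint_comb => // [k kn|].
  apply: (eA k) => v; apply: le_trans (hf_le k v) _; apply: ler_wpM2r => //.
  have cu : c k * nrm k u <= 2.
    have cu0 : 0 <= c k * nrm k u by apply: mulr_ge0 => //; exact: ltW.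
    rewrite -(@ler_pXn2r _ 2) ?nnegrE//.
    rewrite exprMn; apply: le_trans (le_wsq a_ge0 _ kn) _.
    by apply: le_trans u4 _; rewrite -natrX.
  have -> : 2 ^+ k.+1 * a k * nrm k u = (2 ^+ k.+1 * c k) * (c k * nrm k u).
    by rewrite /a; ring.
  have -> : e k = (2 ^+ k.+1 * c k) * 2.
    by rewrite /c (exprSr _ k.+1); field; rewrite expf_neq0.
  apply: ler_wpM2l => //; apply: mulr_ge0; first exact: exprn_ge0.
  exact: ltW.
apply: (eA n) => v.
have rv : r v = (2 ^+ n) * (g v - \sum_(k < n) (a k)%:C * B k v u).
  have -> : r v = (2 ^+ n) * (g v - (\sum_(k < n) (2^-1) ^+ k.+1 *: h k) v) by [].
  rewrite dual_sumE; congr (_ * (_ - _)); apply: eq_bigr => k _.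
  have -> : ((2^-1) ^+ k.+1 *: h k) v = (2^-1) ^+ k.+1 * hf k v by [].
  rewrite /hf rmorphM rmorphXn rmorph_nat !mulrA -exprMn mulVf ?pnatr_eq0//.
  by rewrite expr1n mul1r.
have wn : wsq nrm a n v <= S * nrm n v ^+ 2.
  rewrite /wsq /S mulr_suml; apply: ler_sum => k _; apply: ler_wpM2l => //.
  by rewrite ler_pXn2r ?nnegrE// (nrm_le nrm_mono)// ltnW.
rewrite -(@ler_pXn2r _ 2) ?nnegrE ?mulr_ge0 ?normc_ge0 ?(ltW (e0 n))//.
have -> : normc (r v) ^+ 2 =
    4 ^+ n * normc (g v - \sum_(k < n) (a k)%:C * B k v u) ^+ 2.
  rewrite rv normcM exprMn; congr (_ * _).
  have -> : (2 ^+ n : R[i]) = (2 ^+ n)%:C by rewrite rmorphXn rmorph_nat.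
  by rewrite normcR ?exprn_ge0// -exprM mulnC exprM; congr (_ ^+ _); ring.
have p4 : 0 < 4 ^+ n :> R by rewrite exprn_gt0.
rewrite exprMn; apply: le_trans (ler_wpM2l (ltW p4) (gu v)) _.
rewrite -/(wsq nrm a n v).
have -> : e n ^+ 2 = 4 ^+ n * (S + 1) * d by rewrite mulrC divfK// gt_eqF// mulr_gt0.
rewrite -[leRHS]mulrA -[leRHS]mulrA ler_pM2l// mulrCA ler_pM2l//.
by apply: le_trans wn _; rewrite ler_wpM2r ?exprn_ge0// lerDl.
Qed.

Context {W : nat -> completeNormedModType R[i]}.
Context {iota : forall n, {linear V -> W n}}.
Hypothesis hW : forall n, is_completion (nrm n) (iota n).

Let iota_cont n := completion_continuous hV (hW n).

(** On a bounded [D] the norm [nrm n] is bounded by some [M], so restriction maps an operator-norm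
    ball of radius [e / (2 * (M + 1))], with [M] replaced by its absolute value, into
    [polar D e]. *)
Lemma strong_admissible :
  inductive_admissible iota_cont (Topological.class (strong_dual V)).
Proof.
split; first by apply: strong_lcv; exact: bounded_in_dual.
move=> n f U /= /strong_nbhsP[D [e [bD e0 DU]]].
have [M DM] := (bounded_inP hV nrm_mono D).1 bD n.
have M0 : 0 < `|M| + 1 by rewrite ltr_wpDl.
have d0 : 0 < (e / (2 * (`|M| + 1)))%:C :> R[i].
  by rewrite (ltcR 0) divr_gt0// mulr_gt0.
apply: (@filterS _ _ (nbhs_filter f) _ _ _
  (nbhsx_ballx (f : dual (W n)) _ d0)) => g.
rewrite -ball_normE /= distrC -[`|_|]/((opnorm (g - f))%:C) ltcR => gf.
have -> : restr (@iota_cont n) g = restr (@iota_cont n) f +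
    (restr (@iota_cont n) g - restr (@iota_cont n) f) by rewrite addrC subrK.
apply: DU; apply/polarP; exists (e / 2); first by move: e0; lra.
move=> v Dv.
have -> : (restr (@iota_cont n) g - restr (@iota_cont n) f) v =
  (g - f) (iota n v) by [].
apply: le_trans (normc_le_opnorm _ _) _.
have [-> _] := hW n; rewrite [complex.Re _]/=.
have -> : e / 2 = e / (2 * (`|M| + 1)) * (`|M| + 1).
  by field; rewrite gt_eqF.
apply: ler_pM; [|exact: is_norm_ge0 (countably_normed_norm hV n) v|exact: ltW|].
  by apply: le_trans (opnorm_ub _ (w := 0) _); [exact: normc_ge0 | rewrite normr0].
by apply: le_trans (DM v Dv) _; have := ler_norm M; lra.
Qed.

(** Around [f] in [U], addition and local convexity give a convex open [b] containing 0 with [f + b]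
    inside [U]. Its preimages in the V_k' contain balls of radii [e k], and these radii determine a
    bounded set whose polar lies in [b]. *)
Lemma inductive_sub_strong :
  @open (inductive_dual iota_cont) `<=` @open (strong_dual V).
Proof.
move=> U oU; rewrite strong_openE => f Uf.
have [[addT _ [B cB [oB nB]]] rT] := inductive_dual_admissible iota_cont.
have : nbhs ((f + 0 : dual V) : inductive_dual iota_cont) U.
  by rewrite addr0; exact: open_nbhs_nbhs.
move=> /(addT (f, 0))[[A1 A2] /= [fA1 /nB[b /= [Bb b0] bA2]] AU].
have /choice[e eP] k : exists ek : R, 0 < ek /\
    forall H : dual (W k), opnorm H <= ek -> b (restr (@iota_cont k) H).
  have r0 : restr (@iota_cont k) 0 = 0 by apply: val_inj.
  have : nbhs (restr (@iota_cont k) 0 : inductive_dual iota_cont) b.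
    by rewrite r0; apply: open_nbhs_nbhs; split=> //; exact: oB.
  move=> /(rT k 0)/nbhs_ballP[d /= d0 dP].
  have dE : d = (complex.Re d)%:C by rewrite RRe_real// gtr0_real.
  rewrite dE in d0 dP; rewrite (ltcR 0) in d0.
  (* Halving the radius puts a closed operator-norm ball inside the open one. *)
  exists (complex.Re d / 2); split; first by rewrite divr_gt0.
  move=> H Hd; apply: dP; rewrite -ball_normE /= sub0r normrN.
  rewrite -[`|_|]/((opnorm H)%:C) ltcR; move: Hd d0; lra.
have bm g h : b g -> b h -> b (2^-1 *: (g + h)).
  move=> bg bh.
  have h0 : 0 <= (2^-1 : R[i]) by rewrite invr_ge0.
  have h1 : (2^-1 : R[i]) <= 1 by rewrite invf_le1 ?ler1n.
  have := cB b (mem_set Bb) g h (Itv01 h0 h1) (mem_set bg) (mem_set bh).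
  move=> /set_mem; congr b; rewrite /conv /= scalerDr; congr (_ + _ *: _).
  have twoC : (2 : R[i]) != 0 by rewrite pnatr_eq0.
  by apply: (mulIf twoC); rewrite mulrBl mulVf// mul1r addrK.
(* Such a [g] is the restriction of a functional on [W k] of operator norm at most [e k]. *)
have eb k (g : dual V) : (forall v, normc (g v) <= e k * nrm k v) -> b g.
  move=> gk; have [H Hg Hk] := completion_extension (hW k)
    (@dual_linear _ _ g) (ltW (eP k).1) gk.
  have -> : g = restr (@iota_cont k) H; last exact: (eP k).2.
  by apply: val_inj; apply/funext => v; rewrite /= Hg.
have [D bD DA] := polar_sub_midpoint_convex bm (fun k => (eP k).1) eb.
exists D, 1; split=> // g /DA bg.
apply: (AU (f, g)); split=> /=; last exact: bA2.
exact: (@nbhs_singleton (inductive_dual iota_cont) f _ fA1).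
Qed.

End DualOfCountablyHilbert.

Theorem theorem6p11 (R : realType) (V : topologicalLmodType R[i])
    (nrm : nat -> V -> R) (hV : countably_hilbert nrm)
    (nrm_mono : forall n (v : V), nrm n v <= nrm n.+1 v)
    (W : nat -> completeNormedModType R[i])
    (iota : forall n, {linear V -> W n})
    (hW : forall n, is_completion (nrm n) (iota n)) :
  @open (inductive_dual
           (fun n => completion_continuous (countably_hilbert_normed hV) (hW n)))
    = @open (strong_dual V) :> set_system (dual V) /\
  @open (strong_dual V) = @open (mackey_dual V) :> set_system (dual V).
Proof.
split; apply/seteqP; split.
- exact: inductive_sub_strong.
- exact: (inductive_dual_finest (strong_admissible hV nrm_mono hW)).
- rewrite strong_openE mackey_openE; apply: polar_open_sub => D.
  move=> /(bounded_sub_ellipsoid hV nrm_mono)[a a0 Da].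
  by exists (ellipsoid (nrm := nrm) a) => //; exact: ellipsoid_mackey.
- rewrite strong_openE mackey_openE; apply: polar_open_sub => C [_ _ kC].
  by exists C => //; exact: (weakly_compact_bounded hV nrm_mono).
Qed.
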